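(* Let $\mathcal{A}=\mathbb{C}\langle a,a^*\mid aa^*-a^*a=1\rangle$ be the Weyl algebra, $N=a^*a$, $X=\frac{a+a^*}{\sqrt2}$, $Y=\frac{a-a^*}{\sqrt2}$, and let $$L_5:=Y^2X^2Y^2+(-Y)(X^4-5X^2)Y.$$ Let $\mathcal{A}_+$ be the set of hermitian elements of $\mathcal{A}$ which are positive semi-definite in the Fock-Bargmann representation, let $\operatorname{Pos}(\mathbb{N}_0)=\{f\in\mathbb{C}[N]\mid f(k)\ge0\text{ for all }k\in\mathbb{N}_0\}$, and let $\mathcal{N}'=QM_{\mathcal{A}}(\operatorname{Pos}(\mathbb{N}_0))$ be the quadratic module in $\mathcal{A}$ generated by $\operatorname{Pos}(\mathbb{N}_0)$. Then $L_5+1.4$ belongs to $\mathcal{A}_+\setminus\mathcal{N}'$.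
   Context: $\mathcal{A}$ is the unital complex $*$-algebra generated by $a,a^*$ with the relation $aa^*-a^*a=1$; the involution is conjugate-linear and exchanges $a$ and $a^*$. Thus $YX-XY=1$, $X^*=X$, $Y^*=-Y$. $\mathcal{A}_h=\{x\in\mathcal{A}\mid x^*=x\}$, $\mathbb{N}_0=\{0,1,2,\dots\}$. For $S\subseteq\mathcal{A}_h$, the quadratic module generated by $S$ (for $S$ containing $1$) is $QM_{\mathcal{A}}(S)=\{\sum_{i=1}^m g_i^*s_ig_i\mid m\in\mathbb{N},\ s_i\in S,\ g_i\in\mathcal{A}\}$. Fock-Bargmann representation $\pi_F$: its domain $\mathcal{D}(\pi_F)$ is the space of all sequences $\varphi=(\varphi_n)_{n\in\mathbb{N}_0}\in\ell^2(\mathbb{N}_0)$ with $\sum_k k^M|\varphi_k|^2<\infty$ for all $M\in\mathbb{N}_0$, and on the standard orthonormal basis $(e_k)_{k\in\mathbb{N}_0}$ of $\ell^2(\mathbb{N}_0)$ it acts by $\pi_F(a)e_k=\sqrt{k}\,e_{k-1}$, $\pi_F(a^* )e_k=\sqrt{k+1}\,e_{k+1}$ (with $e_{-1}=0$). $\mathcal{A}_+:=\{x\in\mathcal{A}_h\mid\langle\pi_F(x)\varphi,\varphi\rangle\ge0\text{ for all }\varphi\in\mathcal{D}(\pi_F)\}$. (The representation $\pi_F$ is unitarily equivalent to the Schr\''odinger representation on the Schwartz space $\mathcal{S}(\mathbb{R})$, in which $X$ acts as multiplication by $t$ and $Y$ as $\frac{d}{dt}$.) *)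

(* Defs.v *)
From HB Require Import structures.
From mathcomp Require Import all_boot all_order all_algebra.
From mathcomp Require Import generic_quotient complex.
From mathcomp Require Import ring lra.
From mathcomp Require Import all_classical all_reals all_analysis.

Set Implicit Arguments.
Unset Strict Implicit.
Unset Printing Implicit Defensive.

Import Order.TTheory GRing.Theory Num.Theory.

Local Open Scope classical_set_scope.
Local Open Scope ring_scope.
Local Open Scope complex_scope.
Local Open Scope quotient_scope.

(* The Weyl algebra C< a, a^* | a a^* - a^* a = 1 >, obtained from its        *)
(* presentation: terms over two generators and the complex constants, modulo  *)
(* the least congruence containing the axioms of unital C-algebras and the    *)
(* defining relation.                                                         *)
Inductive wterm (R : rcfType) : Type :=
| WA
| WAs
| WC of R[i]
| WAdd of wterm R & wterm R
| WMul of wterm R & wterm R.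

Arguments WA {R}.
Arguments WAs {R}.

Inductive weq (R : rcfType) : wterm R -> wterm R -> Prop :=
| weq_refl x : weq x x
| weq_sym x y : weq x y -> weq y x
| weq_trans y x z : weq x y -> weq y z -> weq x z
| weq_add x x' y y' : weq x x' -> weq y y' -> weq (WAdd x y) (WAdd x' y')
| weq_mul x x' y y' : weq x x' -> weq y y' -> weq (WMul x y) (WMul x' y')
| weq_addA x y z : weq (WAdd x (WAdd y z)) (WAdd (WAdd x y) z)
| weq_addC x y : weq (WAdd x y) (WAdd y x)
| weq_add0 x : weq (WAdd (WC 0) x) x
| weq_addN x : weq (WAdd (WMul (WC (-1)) x) x) (WC 0)
| weq_mulA x y z : weq (WMul x (WMul y z)) (WMul (WMul x y) z)
| weq_mul1 x : weq (WMul (WC 1) x) x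
| weq_mulDl x y z : weq (WMul (WAdd x y) z) (WAdd (WMul x z) (WMul y z))
| weq_mulDr x y z : weq (WMul x (WAdd y z)) (WAdd (WMul x y) (WMul x z))
| weq_cstD c d : weq (WC (c + d)) (WAdd (WC c) (WC d))
| weq_cstM c d : weq (WC (c * d)) (WMul (WC c) (WC d))
| weq_cstC c x : weq (WMul (WC c) x) (WMul x (WC c))
| weq_rel : weq (WAdd (WMul WA WAs) (WMul (WC (-1)) (WMul WAs WA))) (WC 1).

Fixpoint wterm_star (R : rcfType) (t : wterm R) : wterm R :=
  match t with
  | WA => WAs
  | WAs => WA
  | WC c => WC (conjc c)
  | WAdd x y => WAdd (wterm_star x) (wterm_star y)
  | WMul x y => WMul (wterm_star y) (wterm_star x)
  end.

(* The formulas a e_k = sqrt k e_(k-1) and a^* e_k = sqrt (k+1) e_(k+1), read *)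
(* on coordinates; see fock_a_basis and fock_as_basis.                        *)
Definition fock_a (R : rcfType) (phi : nat -> R[i]) : nat -> R[i] :=
  fun k => (Num.sqrt k.+1%:R)%:C * phi k.+1.

Definition fock_as (R : rcfType) (phi : nat -> R[i]) : nat -> R[i] :=
  fun k => if k is j.+1 then (Num.sqrt k%:R)%:C * phi j else 0.

Fixpoint wterm_fock (R : rcfType) (t : wterm R) (phi : nat -> R[i]) :
    nat -> R[i] :=
  match t with
  | WA => fock_a phi
  | WAs => fock_as phi
  | WC c => fun k => c * phi k
  | WAdd x y => fun k => wterm_fock x phi k + wterm_fock y phi k
  | WMul x y => wterm_fock x (wterm_fock y phi)
  end.

Section WeylAlgebra.
Variable R : rcfType.
Implicit Types (x y z t : wterm R) (phi psi : nat -> R[i]) (c d : R[i]).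

HB.instance Definition _ := gen_eqMixin (wterm R).
HB.instance Definition _ := gen_choiceMixin (wterm R).

Definition weqb : rel (wterm R) := fun x y => `[< weq x y >].

Lemma weqb_equiv : equiv_class_of weqb.
Proof.
split=> [x|x y|y x z]; first exact/asboolP/weq_refl.
- by apply/asbool_equiv_eq; split; apply: weq_sym.
- by move=> /asboolP xy /asboolP yz; apply/asboolP/(weq_trans xy).
Qed.

Canonical weqb_equiv_rel := EquivRelPack weqb_equiv.

Definition weyl : Type := {eq_quot weqb}.

HB.instance Definition _ := Choice.on weyl.

Definition weyl_of (t : wterm R) : weyl := \pi_{eq_quot weqb} t.
Definition weyl_term (u : weyl) : wterm R := repr (u : {eq_quot weqb}).

Lemma weyl_termK u : weyl_of (weyl_term u) = u.
Proof. exact: reprK. Qed.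

Lemma weyl_ofP x y : weyl_of x = weyl_of y <-> weq x y.
Proof.
split=> [/eqquotP/asboolP//|xy]; apply/eqquotP; exact/asboolP.
Qed.

Lemma weyl_term_of t : weq (weyl_term (weyl_of t)) t.
Proof. by apply/weyl_ofP; rewrite weyl_termK. Qed.

Definition weyl_add (u v : weyl) : weyl :=
  weyl_of (WAdd (weyl_term u) (weyl_term v)).
Definition weyl_mul (u v : weyl) : weyl :=
  weyl_of (WMul (weyl_term u) (weyl_term v)).
Definition weyl_opp (u : weyl) : weyl :=
  weyl_of (WMul (WC (-1)) (weyl_term u)).
Definition weyl_scale c (u : weyl) : weyl :=
  weyl_of (WMul (WC c) (weyl_term u)).
Definition weyl_star (u : weyl) : weyl := weyl_of (wterm_star (weyl_term u)).

Lemma weyl_of_add x y : weyl_of (WAdd x y) = weyl_add (weyl_of x) (weyl_of y).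
Proof. apply/weyl_ofP/weq_add; exact/weq_sym/weyl_term_of. Qed.

Lemma weyl_of_mul x y : weyl_of (WMul x y) = weyl_mul (weyl_of x) (weyl_of y).
Proof. apply/weyl_ofP/weq_mul; exact/weq_sym/weyl_term_of. Qed.

Lemma weyl_oppE u : weyl_opp u = weyl_mul (weyl_of (WC (-1))) u.
Proof. by rewrite -{2}(weyl_termK u) -weyl_of_mul. Qed.

Lemma weyl_scaleE c u : weyl_scale c u = weyl_mul (weyl_of (WC c)) u.
Proof. by rewrite -{2}(weyl_termK u) -weyl_of_mul. Qed.

Fact weyl_addA : associative weyl_add.
Proof.
move=> u v w; rewrite -(weyl_termK u) -(weyl_termK v) -(weyl_termK w).
rewrite -!weyl_of_add; exact/weyl_ofP/weq_addA.
Qed.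

Fact weyl_addC : commutative weyl_add.
Proof.
move=> u v; rewrite -(weyl_termK u) -(weyl_termK v) -!weyl_of_add.
exact/weyl_ofP/weq_addC.
Qed.

Fact weyl_add0 : left_id (weyl_of (WC 0)) weyl_add.
Proof.
move=> u; rewrite -(weyl_termK u) -weyl_of_add; exact/weyl_ofP/weq_add0.
Qed.

Fact weyl_addN : left_inverse (weyl_of (WC 0)) weyl_opp weyl_add.
Proof.
move=> u; rewrite weyl_oppE -(weyl_termK u) -weyl_of_mul -weyl_of_add.
exact/weyl_ofP/weq_addN.
Qed.

HB.instance Definition _ :=
  GRing.isZmodule.Build weyl weyl_addA weyl_addC weyl_add0 weyl_addN.

Lemma weyl_ofD x y : weyl_of (WAdd x y) = weyl_of x + weyl_of y.
Proof. exact: weyl_of_add. Qed.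

Fact weyl_mulA : associative weyl_mul.
Proof.
move=> u v w; rewrite -(weyl_termK u) -(weyl_termK v) -(weyl_termK w).
rewrite -!weyl_of_mul; exact/weyl_ofP/weq_mulA.
Qed.

Fact weyl_mul1 : left_id (weyl_of (WC 1)) weyl_mul.
Proof.
move=> u; rewrite -(weyl_termK u) -weyl_of_mul; exact/weyl_ofP/weq_mul1.
Qed.

Fact weyl_mulr1 : right_id (weyl_of (WC 1)) weyl_mul.
Proof.
move=> u; rewrite -[RHS]weyl_mul1 -(weyl_termK u) -!weyl_of_mul.
exact/weyl_ofP/weq_sym/weq_cstC.
Qed.

Fact weyl_mulDl : left_distributive weyl_mul +%R.
Proof.
move=> u v w; rewrite -(weyl_termK u) -(weyl_termK v) -(weyl_termK w).
rewrite -weyl_ofD -!weyl_of_mul -weyl_ofD; exact/weyl_ofP/weq_mulDl.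
Qed.

Fact weyl_mulDr : right_distributive weyl_mul +%R.
Proof.
move=> u v w; rewrite -(weyl_termK u) -(weyl_termK v) -(weyl_termK w).
rewrite -weyl_ofD -!weyl_of_mul -weyl_ofD; exact/weyl_ofP/weq_mulDr.
Qed.

Lemma wterm_fockD t phi psi :
  wterm_fock t (fun k => phi k + psi k) =
  (fun k => wterm_fock t phi k + wterm_fock t psi k).
Proof.
elim: t phi psi => [||c|x IHx y IHy|x IHx y IHy] phi psi /=.
- by apply/funext => k; rewrite /fock_a mulrDr.
- by apply/funext => -[|k]; rewrite /fock_as ?addr0 ?mulrDr.
- by apply/funext => k; rewrite mulrDr.
- by apply/funext => k; rewrite IHx IHy addrACA.
- by rewrite IHy IHx.
Qed.

Lemma wterm_fockZ t c phi :
  wterm_fock t (fun k => c * phi k) = (fun k => c * wterm_fock t phi k).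
Proof.
elim: t phi => [||d|x IHx y IHy|x IHx y IHy] phi /=.
- by apply/funext => k; rewrite /fock_a mulrCA.
- by apply/funext => -[|k]; rewrite /fock_as ?mulr0 // mulrCA.
- by apply/funext => k; rewrite mulrCA.
- by apply/funext => k; rewrite IHx IHy mulrDr.
- by rewrite IHy IHx.
Qed.

Lemma wterm_fock_rel phi k :
  fock_a (fock_as phi) k - fock_as (fock_a phi) k = phi k.
Proof.
have sqrtK n : (Num.sqrt n%:R)%:C * (Num.sqrt n%:R)%:C = n%:R :> R[i].
  by rewrite -rmorphM /= -expr2 sqr_sqrtr ?ler0n // rmorph_nat.
case: k => [|k]; rewrite /fock_a /fock_as mulrA sqrtK ?subr0 ?mul1r//.
by rewrite mulrA sqrtK -mulrBl -natrB// subSnn mul1r.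
Qed.

Lemma wterm_fock_weq x y : weq x y -> wterm_fock x = wterm_fock y.
Proof.
elim=> {x y} /=.
- by [].
- by move=> x y _ ->.
- by move=> y x z _ -> _ ->.
- by move=> x x' y y' _ -> _ ->.
- by move=> x x' y y' _ -> _ ->.
- by move=> x y z; apply/funext => phi; apply/funext => k; rewrite addrA.
- by move=> x y; apply/funext => phi; apply/funext => k; rewrite addrC.
- by move=> x; apply/funext => phi; apply/funext => k; rewrite mul0r add0r.
- move=> x; apply/funext => phi; apply/funext => k.
  by rewrite mulN1r addNr mul0r.
- by [].
- by move=> x; apply/funext => phi; apply/funext => k; rewrite mul1r.
- by [].
- by move=> x y z; apply/funext => phi; rewrite wterm_fockD.
- by move=> c d; apply/funext => phi; apply/funext => k; rewrite mulrDl.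
- by move=> c d; apply/funext => phi; apply/funext => k; rewrite mulrA.
- by move=> c x; apply/funext => phi; rewrite wterm_fockZ.
- apply/funext => phi; apply/funext => k.
  by rewrite mulN1r mul1r wterm_fock_rel.
Qed.

Fact weyl_oner_neq0 : weyl_of (WC 1) != 0.
Proof.
apply/eqP => /weyl_ofP/wterm_fock_weq/(congr1 (fun f => f (fun=> 1) 0%N))/=.
by rewrite !mulr1; apply/eqP/oner_neq0.
Qed.

HB.instance Definition _ := GRing.Zmodule_isNzRing.Build weyl
  weyl_mulA weyl_mul1 weyl_mulr1 weyl_mulDl weyl_mulDr weyl_oner_neq0.

Lemma weyl_ofM x y : weyl_of (WMul x y) = weyl_of x * weyl_of y.
Proof. exact: weyl_of_mul. Qed.

Lemma weyl_cstD c d : weyl_of (WC (c + d)) = weyl_of (WC c) + weyl_of (WC d).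
Proof. by rewrite -weyl_ofD; apply/weyl_ofP/weq_cstD. Qed.

Lemma weyl_cstM c d : weyl_of (WC (c * d)) = weyl_of (WC c) * weyl_of (WC d).
Proof. by rewrite -weyl_ofM; apply/weyl_ofP/weq_cstM. Qed.

Lemma weyl_cstC c (u : weyl) : weyl_of (WC c) * u = u * weyl_of (WC c).
Proof.
rewrite -(weyl_termK u) -!weyl_ofM.
exact/weyl_ofP/weq_cstC.
Qed.

Fact weyl_scalerA c d u : weyl_scale c (weyl_scale d u) = weyl_scale (c * d) u.
Proof. by rewrite !weyl_scaleE weyl_cstM; apply: mulrA. Qed.

Fact weyl_scale1 : left_id 1 weyl_scale.
Proof. by move=> u; rewrite weyl_scaleE; apply: mul1r. Qed.

Fact weyl_scalerDr : right_distributive weyl_scale +%R.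
Proof. by move=> c u v; rewrite !weyl_scaleE; apply: mulrDr. Qed.

Fact weyl_scalerDl u : {morph weyl_scale^~ u : c d / c + d}.
Proof. by move=> c d; rewrite !weyl_scaleE weyl_cstD; apply: mulrDl. Qed.

HB.instance Definition _ := GRing.Zmodule_isLmodule.Build R[i] weyl
  weyl_scalerA weyl_scale1 weyl_scalerDr weyl_scalerDl.

Lemma weyl_scaleM c (u : weyl) : c *: u = weyl_of (WC c) * u.
Proof. exact: weyl_scaleE. Qed.

Fact weyl_scalerAl c (u v : weyl) : c *: (u * v) = c *: u * v.
Proof. by rewrite !weyl_scaleM mulrA. Qed.

HB.instance Definition _ :=
  GRing.Lmodule_isLalgebra.Build R[i] weyl weyl_scalerAl.

Fact weyl_scalerAr c (u v : weyl) : c *: (u * v) = u * (c *: v).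
Proof. by rewrite !weyl_scaleM !mulrA weyl_cstC. Qed.

HB.instance Definition _ :=
  GRing.Lalgebra_isAlgebra.Build R[i] weyl weyl_scalerAr.

Lemma weyl_ofC c : weyl_of (WC c) = c%:A.
Proof. by rewrite weyl_scaleM mulr1. Qed.

Definition weyl_a : weyl := weyl_of WA.
Definition weyl_as : weyl := weyl_of WAs.

Lemma weyl_rel : weyl_a * weyl_as - weyl_as * weyl_a = 1.
Proof.
have /weyl_ofP := weq_rel R.
by rewrite !(weyl_ofD, weyl_ofM, weyl_ofC) scaleN1r mulN1r scale1r.
Qed.

#[local] Arguments conjc : simpl never.

Lemma wterm_star_weq x y : weq x y -> weq (wterm_star x) (wterm_star y).
Proof.
have conjcN1 : conjc (-1) = -1 :> R[i] by rewrite (rmorphN1 (@conjc R)).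
have conjcD c d : conjc (c + d) = conjc c + conjc d :> R[i].
  exact: (rmorphD (@conjc R)).
have conjcM c d : conjc (c * d) = conjc c * conjc d :> R[i].
  exact: (rmorphM (@conjc R)).
elim=> {x y} /=.
- by move=> x; exact: weq_refl.
- by move=> x y _; exact: weq_sym.
- by move=> y x z _ + _; exact: weq_trans.
- by move=> x x' y y' _ + _; exact: weq_add.
- by move=> x x' y y' _ xx' _ yy'; exact: weq_mul.
- by move=> x y z; exact: weq_addA.
- by move=> x y; exact: weq_addC.
- by move=> x; rewrite conjc0; exact: weq_add0.
- move=> x; rewrite conjc0 conjcN1.
  apply: (weq_trans _ (weq_addN _)); apply: weq_add; last exact: weq_refl.
  exact/weq_sym/weq_cstC.
- by move=> x y z; exact/weq_sym/weq_mulA.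
- move=> x; rewrite conjc1.
  by apply: (weq_trans _ (weq_mul1 _)); exact/weq_sym/weq_cstC.
- by move=> x y z; exact: weq_mulDr.
- by move=> x y z; exact: weq_mulDl.
- by move=> c d; rewrite conjcD; exact: weq_cstD.
- by move=> c d; rewrite conjcM mulrC; exact: weq_cstM.
- by move=> c x; exact/weq_sym/weq_cstC.
- rewrite conjc1 conjcN1; apply: (weq_trans _ (weq_rel R)).
  by apply: weq_add; [exact: weq_refl|exact/weq_sym/weq_cstC].
Qed.

Lemma weyl_star_of t : weyl_star (weyl_of t) = weyl_of (wterm_star t).
Proof. by apply/weyl_ofP/wterm_star_weq/weyl_term_of. Qed.

Lemma weyl_star_a : weyl_star weyl_a = weyl_as.
Proof. exact: weyl_star_of. Qed.

Lemma weyl_star_as : weyl_star weyl_as = weyl_a.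
Proof. exact: weyl_star_of. Qed.

Lemma weyl_starD u v : weyl_star (u + v) = weyl_star u + weyl_star v.
Proof.
by rewrite -(weyl_termK u) -(weyl_termK v) -weyl_ofD !weyl_star_of weyl_ofD.
Qed.

Lemma weyl_starM u v : weyl_star (u * v) = weyl_star v * weyl_star u.
Proof.
by rewrite -(weyl_termK u) -(weyl_termK v) -weyl_ofM !weyl_star_of weyl_ofM.
Qed.

Lemma weyl_starZ c u : weyl_star (c *: u) = conjc c *: weyl_star u.
Proof.
rewrite -(weyl_termK u) !weyl_scaleM -weyl_ofM !weyl_star_of weyl_ofM.
by rewrite weyl_cstC.
Qed.

Lemma weyl_starK : involutive weyl_star.
Proof.
move=> u; rewrite -(weyl_termK u) !weyl_star_of; congr weyl_of.
elim: (weyl_term u) => //= [c|x -> y ->//|x -> y ->//].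
by rewrite conjcK.
Qed.

Definition weyl_herm : set weyl := [set u | weyl_star u = u].

Definition quadratic_module (S : set weyl) : set weyl :=
  [set u | exists (m : nat) (s g : 'I_m -> weyl),
     [/\ (0 < m)%N, forall i, S (s i)
       & u = \sum_(i < m) weyl_star (g i) * s i * g i]].

Definition weyl_N : weyl := weyl_as * weyl_a.
Definition weyl_X : weyl := ((Num.sqrt 2)%:C)^-1 *: (weyl_a + weyl_as).
Definition weyl_Y : weyl := ((Num.sqrt 2)%:C)^-1 *: (weyl_a - weyl_as).

Lemma weyl_X_herm : weyl_star weyl_X = weyl_X.
Proof.
rewrite weyl_starZ weyl_starD weyl_star_a weyl_star_as addrC.
by rewrite (fmorphV (@conjc R)) /= conjc_real.
Qed.

Lemma weyl_YX : weyl_Y * weyl_X - weyl_X * weyl_Y = 1.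
Proof.
rewrite -!(scalerAl, scalerAr) !scalerA -scalerBr.
have -> : (weyl_a - weyl_as) * (weyl_a + weyl_as)
    - (weyl_a + weyl_as) * (weyl_a - weyl_as)
    = (weyl_a * weyl_as - weyl_as * weyl_a) *+ 2.
  rewrite !(mulrDl, mulrDr, mulrN, mulNr, opprD, opprK, mulr2n).
  set p := weyl_a * weyl_as; set q := weyl_as * weyl_a.
  rewrite addrACA (addrACA _ p) subrr add0r (addrACA (- q)) addNr addr0.
  by rewrite -addrACA.
rewrite weyl_rel -invfM -rmorphM /= -expr2 sqr_sqrtr ?ler0n//.
by rewrite rmorph_nat -(scaler_nat 2 (1 : weyl)) scalerA mulVf ?scale1r
  ?pnatr_eq0.
Qed.

Definition weyl_L5 : weyl :=
  weyl_Y ^+ 2 * weyl_X ^+ 2 * weyl_Y ^+ 2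
  + (- weyl_Y) * (weyl_X ^+ 4 - 5 * weyl_X ^+ 2) * weyl_Y.

Definition PosN0 : set weyl :=
  [set horner_alg weyl_N f |
     f in [set f : {poly R[i]} | forall k : nat, 0 <= f.[k%:R]]].

(* [fock u] acts by the coordinate formulas on arbitrary sequences; the       *)
(* representation pi_F is its restriction to the invariant subspace           *)
(* [fock_domain].                                                             *)
Definition fock (u : weyl) (phi : nat -> R[i]) : nat -> R[i] :=
  wterm_fock (weyl_term u) phi.

Lemma fock_of t : fock (weyl_of t) = wterm_fock t.
Proof. exact/wterm_fock_weq/weyl_term_of. Qed.

Lemma fockD u v phi k : fock (u + v) phi k = fock u phi k + fock v phi k.
Proof. by rewrite -(weyl_termK u) -(weyl_termK v) -weyl_ofD !fock_of. Qed.

Lemma fockM u v phi : fock (u * v) phi = fock u (fock v phi).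
Proof. by rewrite -(weyl_termK u) -(weyl_termK v) -weyl_ofM !fock_of. Qed.

Lemma fockZ c u phi k : fock (c *: u) phi k = c * fock u phi k.
Proof. by rewrite weyl_scaleM fockM fock_of. Qed.

Lemma fock1 phi : fock 1 phi = phi.
Proof.
by rewrite -[1]scale1r -weyl_ofC fock_of; apply/funext => k /=; rewrite mul1r.
Qed.

Definition fock_basis (k : nat) : nat -> R[i] := fun j => (j == k)%:R.

Lemma fock_a_basis k :
  fock weyl_a (fock_basis k) =
  fun j => (Num.sqrt k%:R)%:C * if k is k'.+1 then fock_basis k' j else 0.
Proof.
rewrite fock_of; apply/funext => j; rewrite /= /fock_a /fock_basis.
case: k => [|k]; first by rewrite mulr0 mulr0.
by rewrite eqSS; case: eqP => [->//|_]; rewrite !mulr0.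
Qed.

Lemma fock_as_basis k :
  fock weyl_as (fock_basis k) =
  fun j => (Num.sqrt k.+1%:R)%:C * fock_basis k.+1 j.
Proof.
rewrite fock_of; apply/funext => -[|j]; rewrite /= /fock_as /fock_basis.
  by rewrite mulr0.
by rewrite eqSS; case: eqP => [->//|_]; rewrite !mulr0.
Qed.

End WeylAlgebra.

Arguments weyl_herm R _ : clear implicits.
Arguments PosN0 R _ : clear implicits.

Import numFieldNormedType.Exports.

Section FockPositivity.
Variable R : realType.
Implicit Types (phi psi : nat -> R[i]) (u : weyl R).

Definition fock_domain : set (nat -> R[i]) :=
  [set phi | forall M : nat,
     (\sum_(0 <= k <oo)
        ((k%:R ^+ M : R) * Normc.normc (phi k) ^+ 2)%:E < +oo)%E].

Definition inner (phi psi : nat -> R[i]) : R[i] :=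
  limn (series (fun k => complex.Re (phi k * conjc (psi k)))) +i*
  limn (series (fun k => complex.Im (phi k * conjc (psi k)))).

Definition Aplus : set (weyl R) :=
  [set u | weyl_herm R u /\
     forall phi, fock_domain phi -> 0 <= inner (fock u phi) phi].

Local Notation weight M phi :=
  (fun k : nat => ((k%:R ^+ M : R) * Normc.normc (phi k) ^+ 2)%:E).

Fact weight_ge0 M phi k : (0 <= weight M phi k)%E.
Proof. by rewrite lee_fin mulr_ge0 ?sqr_ge0 ?exprn_ge0 ?ler0n. Qed.

Fact normc_real (r : R) (c : R[i]) :
  Normc.normc (r%:C * c) ^+ 2 = r ^+ 2 * Normc.normc c ^+ 2.
Proof.
rewrite Normc.normcM exprMn; congr (_ * _).
by rewrite /Normc.normc /= expr0n addr0 sqr_sqrtr ?sqr_ge0.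
Qed.

Lemma fock_domain_a phi : fock_domain phi -> fock_domain (fock_a phi).
Proof.
move=> D M; apply: le_lt_trans (D M.+1).
rewrite [leRHS]nneseries_recl//; last by move=> k _; exact: weight_ge0.
rewrite expr0n/= mul0r add0e -[leRHS](nneseries_addn 1); last first.
  by move=> k; exact: weight_ge0.
apply: lee_nneseries => [k _ _|k _]; first exact: weight_ge0.
rewrite lee_fin addn1 /fock_a normc_real sqr_sqrtr ?ler0n// mulrA.
by rewrite ler_wpM2r ?sqr_ge0// exprSr ler_wpM2r// lerXn2r ?nnegrE ?ler_nat.
Qed.

Lemma fock_domain_as phi : fock_domain phi -> fock_domain (fock_as phi).
Proof.
move=> D M; have D0 := D 0%N; have DM := D M.+1.
rewrite nneseries_recl//; last by move=> k _; exact: weight_ge0.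
rewrite -[fock_as phi 0]/(0 : R[i]) Normc.normc0 (expr0n _ 2) mulr0.
rewrite add0e -(nneseries_addn 1); last first.
  by move=> k; exact: weight_ge0.
apply: (@le_lt_trans _ _ (\sum_(0 <= k <oo)
    (weight 0%N phi k + (2 ^+ M.+1)%:E * weight M.+1 phi k))%E).
  apply: lee_nneseries => [k _ _|k _]; first exact: weight_ge0.
  rewrite addn1 /fock_as normc_real sqr_sqrtr ?ler0n// mulrA -exprSr.
  rewrite -EFinM -EFinD lee_fin expr0
    [2 ^+ _ * (_ * _)]mulrA -mulrDl ler_wpM2r ?sqr_ge0//.
  case: k => [|k]; first by rewrite expr1n lerDl mulr_ge0 ?exprn_ge0.
  rewrite -exprMn (@le_trans _ _ ((2 * k.+1%:R) ^+ M.+1))// ?lerDr//.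
  rewrite lerXn2r ?nnegrE ?mulr_ge0// -natrM ler_nat mul2n -addnn.
  by rewrite addnS ltnS; exact: leq_addr.
rewrite nneseriesD; [|by move=> k _ _; exact: weight_ge0|]; last first.
  by move=> k _ _; rewrite mule_ge0 ?weight_ge0// lee_fin exprn_ge0.
rewrite nneseriesZl; last by move=> k _; exact: weight_ge0.
by rewrite lte_add_pinfty// lte_mul_pinfty ?lee_fin ?exprn_ge0.
Qed.

Lemma fock_domainZ c phi :
  fock_domain phi -> fock_domain (fun k => c * phi k).
Proof.
move=> D M; rewrite (eq_eseriesr (g := fun k =>
    ((Normc.normc c ^+ 2)%:E * weight M phi k)%E)); last first.
  by move=> k _; rewrite Normc.normcM exprMn -EFinM mulrCA.
rewrite nneseriesZl; last by move=> k _; exact: weight_ge0.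
by rewrite lte_mul_pinfty ?lee_fin ?sqr_ge0.
Qed.

Lemma fock_domainD phi psi : fock_domain phi -> fock_domain psi ->
  fock_domain (fun k => phi k + psi k).
Proof.
move=> Dphi Dpsi M.
apply: (@le_lt_trans _ _ (\sum_(0 <= k <oo)
    (2%:E * weight M phi k + 2%:E * weight M psi k))%E).
  apply: lee_nneseries => [k _ _|k _].
    exact: (weight_ge0 M (fun k => phi k + psi k)).
  rewrite -!EFinM -EFinD lee_fin !(mulrCA 2) -mulrDr.
  rewrite ler_wpM2l ?exprn_ge0 ?ler0n//.
  set a := Normc.normc (phi k); set b := Normc.normc (psi k).
  have normc_ge0 (c : R[i]) : 0 <= Normc.normc c.
    by case: c => ? ?; exact: sqrtr_ge0.
  have a0 : 0 <= a by exact: normc_ge0.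
  have b0 : 0 <= b by exact: normc_ge0.
  apply: (@le_trans _ _ ((a + b) ^+ 2)).
    by rewrite lerXn2r ?nnegrE ?addr_ge0 ?normc_ge0// le_normcD.
  by have := sqr_ge0 (a - b); nra.
rewrite nneseriesD; try by move=> k _ _; rewrite mule_ge0 ?weight_ge0 ?lee_fin.
rewrite !nneseriesZl; try by move=> k _; exact: weight_ge0.
by rewrite lte_add_pinfty// lte_mul_pinfty ?lee_fin.
Qed.

Lemma fock_domain_fock u phi : fock_domain phi -> fock_domain (fock u phi).
Proof.
rewrite /fock.
elim: (weyl_term u) phi => /= [||c|x IHx y IHy|x IHx y IHy] phi D.
- exact: fock_domain_a.
- exact: fock_domain_as.
- exact: fock_domainZ.
- by apply: fock_domainD; [exact: IHx|exact: IHy].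
- exact/IHx/IHy.
Qed.

Lemma is_cvg_inner phi psi : fock_domain phi -> fock_domain psi ->
  cvgn (series (fun k => complex.Re (phi k * conjc (psi k)))) /\
  cvgn (series (fun k => complex.Im (phi k * conjc (psi k)))).
Proof.
move=> /(_ 0%N) Dphi /(_ 0%N) Dpsi.
pose b k : R := Normc.normc (phi k) ^+ 2 + Normc.normc (psi k) ^+ 2.
have bcvg : cvgn (series b).
  apply: nnseries_is_cvg.
    by move=> k; rewrite addr_ge0 ?sqr_ge0.
  rewrite (eq_eseriesr (g := fun k => (weight 0%N phi k + weight 0%N psi k)%E)).
    rewrite nneseriesD; try by move=> k _ _; exact: weight_ge0.
    by rewrite lte_add_pinfty.
  by move=> k _; rewrite !expr0 !mul1r.
have le_b (x y z t : R) :
    `|x * z + y * t| <= x ^+ 2 + y ^+ 2 + (z ^+ 2 + t ^+ 2).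
  rewrite ler_norml; apply/andP; split.
    have := sqr_ge0 (x + z); have := sqr_ge0 (y + t).
    by have := sqr_ge0 x; have := sqr_ge0 y; have := sqr_ge0 z;
      have := sqr_ge0 t; nra.
  have := sqr_ge0 (x - z); have := sqr_ge0 (y - t).
  by have := sqr_ge0 x; have := sqr_ge0 y; have := sqr_ge0 z;
    have := sqr_ge0 t; nra.
split; apply: normed_cvg; apply: (series_le_cvg _ _ _ bcvg) => k //=;
  rewrite /b ?addr_ge0 ?sqr_ge0//; case: (phi k) (psi k) => x y [z t] /=;
  rewrite !sqr_sqrtr ?addr_ge0 ?sqr_ge0//.
- by rewrite mulrN opprK.
- by have := le_b x y (- t) z; rewrite sqrrN mulrN [t ^+ 2 + _]addrC addrC.
Qed.

End FockPositivity.

Arguments fock_domain R _ : clear implicits.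
Arguments Aplus R _ : clear implicits.

(* Main.v *)
Require Import Defs.
From mathcomp Require Import all_boot all_order all_algebra.
From mathcomp Require Import complex polyrcf ring lra zify.
From mathcomp Require Import all_classical all_reals all_analysis.

Import Order.TTheory GRing.Theory Num.Theory.
Import numFieldNormedType.Exports.

Local Open Scope classical_set_scope.
Local Open Scope ring_scope.

(** Positivity. In the number basis [L5 + 7/5] is a band matrix whose only
    nonzero entries are on the diagonal, of size about [k^3], and at distances
    2 and 4 ([barg_L5]). Each off-diagonal pair is bounded by the arithmetic-
    geometric inequality with weights [A B = |entry|^2] ([amgm]); the weights
    can be chosen so that for every [k] the four weights meeting the diagonal
    entry [k] add up to at most that entry ([dominance]). Rearranging the series
    of the quadratic form costs only boundary terms, which tend to 0 because
    vectors of the domain decay faster than any power ([series_raise2_cvg0],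
    [series_raise4_cvg0]); hence the form is nonnegative ([energy_ge0]).

    Separation. Suppose [L5 + 7/5] is a sum of terms [g^* f(N) g] with [f]
    nonnegative on the natural numbers. The diagonal entry of such a term at
    [e_k] is a sum of nonnegative contributions, one for each component of [g]
    of a given weight for the number operator, and each contribution is a
    polynomial in [k] ([weyl_decomposable], [diag_ge]). All of them are bounded
    by the diagonal entry of [L5 + 7/5], a cubic in [k], so
    [deg g + deg f <= 3] ([degree_bound]). In particular [g] is a noncommutative
    polynomial of degree at most 3 in [X] and [Y] ([filt3_spanned]).

    What remains is the noncommutative version of the classical argument that
    the Motzkin polynomial is no sum of squares. The coefficients of [X^6],
    [Y^6], and then those of [X^4], [Y^4], vanish in [L5 + 7/5] but are sums of
    nonnegative quantities in the terms; this removes [X^3], [Y^3], [X^2], [Y^2]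
    from every [g] and every [f] of degree at least 2. On squares of the
    surviving elements, spanned by [1, X, Y, XY, X^2 Y, X Y^2], an explicit
    linear functional [ell] is nonnegative, while [ell (L5 + 7/5) = - 3/80].
    The successive tests are packaged as the predicate [lex_ge0], which is
    closed under sums ([lex_ge0D]), holds for every term ([lex_ge0_term]) and
    fails for [L5 + 7/5] ([not_lex_shifted]). *)

Section WeylSeparation.

Local Open Scope complex_scope.

Set Implicit Arguments.
Unset Strict Implicit.

(** * Representations of the Weyl algebra on sequences *)

(** On the coefficients of a power series, [raise] is multiplication by the
    variable and [lower] is differentiation; their commutator is 1. *)
Definition raise (V : nmodType) (p : nat -> V) : nat -> V :=
  fun k => if k is j.+1 then p j else 0.

Definition lower (K : pzRingType) (p : nat -> K) : nat -> K :=
  fun k => k.+1%:R * p k.+1.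

Section Representation.
Variables (R : rcfType) (P Q : (nat -> R[i]) -> nat -> R[i]).

Fixpoint act_term (t : wterm R) (p : nat -> R[i]) : nat -> R[i] :=
  match t with
  | WA => P p
  | WAs => Q p
  | WC c => fun k => c * p k
  | WAdd x y => fun k => act_term x p k + act_term y p k
  | WMul x y => act_term x (act_term y p)
  end.

Definition act (u : weyl R) := act_term (weyl_term u).

Definition lin_op (T : (nat -> R[i]) -> nat -> R[i]) :=
  forall c p q, T (fun k => c * p k + q k) = (fun k => c * T p k + T q k).

Hypotheses (linP : lin_op P) (linQ : lin_op Q).
Hypothesis PQ : forall p k, P (Q p) k - Q (P p) k = p k.

Lemma act_term_lin t : lin_op (act_term t).
Proof.
elim: t => [||d|x IHx y IHy|x IHx y IHy] c p q //=.
- by apply/funext => k; ring.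
- by rewrite IHx IHy; apply/funext => k; ring.
- by rewrite IHy IHx.
Qed.

Lemma act_termD t p q :
  act_term t (fun k => p k + q k) = (fun k => act_term t p k + act_term t q k).
Proof.
have := act_term_lin t 1 p q; under [in LHS]eq_fun do rewrite mul1r.
by move=> ->; apply/funext => k; rewrite mul1r.
Qed.

Lemma act_term0 t : act_term t (fun=> 0) = (fun=> 0).
Proof.
have := act_term_lin t (-1) (fun=> 0) (fun=> 0).
under [in LHS]eq_fun do rewrite mulr0 addr0.
by move=> ->; apply/funext => k; rewrite mulN1r addNr.
Qed.

Lemma act_termZ t c p :
  act_term t (fun k => c * p k) = (fun k => c * act_term t p k).
Proof.
have := act_term_lin t c p (fun=> 0); under [in LHS]eq_fun do rewrite addr0.
by move=> ->; apply/funext => k; rewrite act_term0 addr0.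
Qed.

(** The defining relation of the algebra is the commutation relation [PQ], so
    every pair of operators satisfying it gives a representation. Two such
    pairs are used below. *)
Lemma act_term_weq x y : weq x y -> act_term x = act_term y.
Proof.
elim=> {x y} //=.
- by move=> y x z _ -> _ ->.
- by move=> x x' y y' _ -> _ ->.
- by move=> x x' y y' _ -> _ ->.
- by move=> x y z; apply/funext => p; apply/funext => k; rewrite addrA.
- by move=> x y; apply/funext => p; apply/funext => k; rewrite addrC.
- by move=> x; apply/funext => p; apply/funext => k; rewrite mul0r add0r.
- by move=> x; apply/funext => p; apply/funext => k; rewrite mulN1r addNr mul0r.
- by move=> x; apply/funext => p; apply/funext => k; rewrite mul1r.
- by move=> x y z; apply/funext => p; rewrite act_termD.
- by move=> c d; apply/funext => p; apply/funext => k; rewrite mulrDl.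
- by move=> c d; apply/funext => p; apply/funext => k; rewrite mulrA.
- by move=> c x; apply/funext => p; rewrite act_termZ.
- by apply/funext => p; apply/funext => k; rewrite mulN1r mul1r PQ.
Qed.

Lemma act_of t : act (weyl_of t) = act_term t.
Proof. exact/act_term_weq/weyl_term_of. Qed.

Lemma actD u v p k : act (u + v) p k = act u p k + act v p k.
Proof. by rewrite -(weyl_termK u) -(weyl_termK v) -weyl_ofD !act_of. Qed.

Lemma actM u v p : act (u * v) p = act u (act v p).
Proof. by rewrite -(weyl_termK u) -(weyl_termK v) -weyl_ofM !act_of. Qed.

Lemma actZ c u p k : act (c *: u) p k = c * act u p k.
Proof. by rewrite weyl_scaleM actM act_of. Qed.

Lemma act1 p : act 1 p = p.
Proof.
by rewrite -[1]scale1r -weyl_ofC act_of; apply/funext => k /=; rewrite mul1r.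
Qed.

Lemma actN u p k : act (- u) p k = - act u p k.
Proof. by rewrite -scaleN1r actZ mulN1r. Qed.

Lemma act0 p k : act 0 p k = 0.
Proof. by rewrite -(scale0r 1) actZ mul0r. Qed.

Lemma act_sum (I : Type) (r : seq I) (F : I -> weyl R) p k :
  act (\sum_(i <- r) F i) p k = \sum_(i <- r) act (F i) p k.
Proof.
elim: r => [|i r IH]; first by rewrite !big_nil act0.
by rewrite !big_cons actD IH.
Qed.

Lemma act_a p : act (weyl_a R) p = P p.
Proof. by rewrite act_of. Qed.

Lemma act_as p : act (weyl_as R) p = Q p.
Proof. by rewrite act_of. Qed.

End Representation.

Section TwoModels.
Variable R : rcfType.
Local Notation C := R[i].
Implicit Types (p q : nat -> C) (u v : weyl R).

Lemma raise_lin : lin_op (@raise C).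
Proof. by move=> c p q; apply/funext => -[|k] /=; rewrite ?mulr0 ?addr0. Qed.

Lemma lower_lin : lin_op (@lower C).
Proof. by move=> c p q; apply/funext => k; rewrite /lower; ring. Qed.

Lemma lower_raise p k : lower (raise p) k - raise (lower p) k = p k.
Proof. by case: k => [|k]; rewrite /lower /raise; ring. Qed.

(** The Fock representation on the unnormalised basis [sqrt (k!) e_k], on which
    no square roots occur: [a] is differentiation, [a^*] is multiplication by
    the variable. *)
Definition barg : weyl R -> (nat -> C) -> nat -> C := act (@lower C) (@raise C).

Definition rsqrt2 : C := ((Num.sqrt 2)%:C)^-1.

Lemma rsqrt2_sqr : rsqrt2 * rsqrt2 = 2^-1.
Proof.
rewrite -invfM -rmorphM /= -expr2 sqr_sqrtr ?ler0n //.
by rewrite (rmorph_nat (real_complex R)).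
Qed.

Definition schr_a p : nat -> C := fun k => rsqrt2 * (raise p k + lower p k).
Definition schr_as p : nat -> C := fun k => rsqrt2 * (raise p k - lower p k).
(** The action on polynomials in one variable where [X] is multiplication by
    the variable and [Y] is differentiation. It serves to read off the
    coefficients of the words [X^i Y^j]. *)
Definition schr : weyl R -> (nat -> C) -> nat -> C := act schr_a schr_as.

Lemma schr_a_lin : lin_op schr_a.
Proof.
by move=> c p q; apply/funext => k; rewrite /schr_a raise_lin lower_lin; ring.
Qed.

Lemma schr_as_lin : lin_op schr_as.
Proof.
by move=> c p q; apply/funext => k; rewrite /schr_as raise_lin lower_lin; ring.
Qed.

Lemma schr_rel p k : schr_a (schr_as p) k - schr_as (schr_a p) k = p k.
Proof.
have s2 := rsqrt2_sqr.
have e2 : 2 * 2^-1 = 1 :> C by rewrite mulfV ?pnatr_eq0.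
rewrite -[RHS]mul1r -e2 -s2.
case: k => [|k]; rewrite /schr_a /schr_as /lower /raise; ring.
Qed.

Lemma bargD u v p k : barg (u + v) p k = barg u p k + barg v p k.
Proof. exact: (actD lower_lin raise_lin lower_raise). Qed.
Lemma bargM u v p : barg (u * v) p = barg u (barg v p).
Proof. exact: (actM lower_lin raise_lin lower_raise). Qed.
Lemma bargZ c u p k : barg (c *: u) p k = c * barg u p k.
Proof. exact: (actZ lower_lin raise_lin lower_raise). Qed.
Lemma bargN u p k : barg (- u) p k = - barg u p k.
Proof. exact: (actN lower_lin raise_lin lower_raise). Qed.
Lemma barg1 p : barg 1 p = p.
Proof. exact: (act1 lower_lin raise_lin lower_raise). Qed.
Lemma barg_a p : barg (weyl_a R) p = lower p.
Proof. exact: (act_a lower_lin raise_lin lower_raise). Qed.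
Lemma barg_as p : barg (weyl_as R) p = raise p.
Proof. exact: (act_as lower_lin raise_lin lower_raise). Qed.

Lemma schrD u v p k : schr (u + v) p k = schr u p k + schr v p k.
Proof. exact: (actD schr_a_lin schr_as_lin schr_rel). Qed.
Lemma schrM u v p : schr (u * v) p = schr u (schr v p).
Proof. exact: (actM schr_a_lin schr_as_lin schr_rel). Qed.
Lemma schrZ c u p k : schr (c *: u) p k = c * schr u p k.
Proof. exact: (actZ schr_a_lin schr_as_lin schr_rel). Qed.
Lemma schrN u p k : schr (- u) p k = - schr u p k.
Proof. exact: (actN schr_a_lin schr_as_lin schr_rel). Qed.
Lemma schr1 p : schr 1 p = p.
Proof. exact: (act1 schr_a_lin schr_as_lin schr_rel). Qed.
Lemma schr_wa p : schr (weyl_a R) p = schr_a p.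
Proof. exact: (act_a schr_a_lin schr_as_lin schr_rel). Qed.
Lemma schr_was p : schr (weyl_as R) p = schr_as p.
Proof. exact: (act_as schr_a_lin schr_as_lin schr_rel). Qed.

Lemma schr_X p : schr (weyl_X R) p = raise p.
Proof.
apply/funext => k; rewrite schrZ schrD schr_wa schr_was /schr_a /schr_as.
rewrite -/rsqrt2 -mulrDr mulrA rsqrt2_sqr.
by field.
Qed.

Lemma schr_Y p : schr (weyl_Y R) p = lower p.
Proof.
apply/funext => k; rewrite schrZ schrD schrN schr_wa schr_was /schr_a /schr_as.
rewrite -/rsqrt2 -mulrBr mulrA rsqrt2_sqr.
by field.
Qed.

End TwoModels.

(** * The operator in the number basis *)

Section Operator.
Variable R : rcfType.
Local Notation C := R[i].
Implicit Types (p q : nat -> C) (u v : weyl R).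

Lemma weyl_L5_words : weyl_L5 R =
  weyl_Y R * weyl_Y R * weyl_X R * weyl_X R * weyl_Y R * weyl_Y R
  - weyl_Y R * weyl_X R * weyl_X R * weyl_X R * weyl_X R * weyl_Y R
  + 5 *: (weyl_Y R * weyl_X R * weyl_X R * weyl_Y R).
Proof.
rewrite /weyl_L5; move: (weyl_X R) (weyl_Y R) => X Y.
rewrite !mulNr mulrBr mulrBl opprB mulr_natl -[_ *+ 5]scaler_nat.
rewrite !exprS !expr0 !mulr1 -?(scalerAr, scalerAl) !mulrA -addrA.
by congr (_ + _); rewrite addrC.
Qed.

Lemma weyl_L5E :
  weyl_L5 R = 8^-1 *: ((weyl_a R - weyl_as R) * (weyl_a R - weyl_as R) *
     (weyl_a R + weyl_as R) * (weyl_a R + weyl_as R) *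
     (weyl_a R - weyl_as R) * (weyl_a R - weyl_as R))
  - 8^-1 *: ((weyl_a R - weyl_as R) * (weyl_a R + weyl_as R) *
     (weyl_a R + weyl_as R) * (weyl_a R + weyl_as R) *
     (weyl_a R + weyl_as R) * (weyl_a R - weyl_as R))
  + (5 / 4) *: ((weyl_a R - weyl_as R) * (weyl_a R + weyl_as R) *
     (weyl_a R + weyl_as R) * (weyl_a R - weyl_as R)).
Proof.
rewrite weyl_L5_words /weyl_X /weyl_Y -/(rsqrt2 R).
set x := weyl_a R + weyl_as R; set y := weyl_a R - weyl_as R.
have e8 : 8^-1 = 2^-1 * 2^-1 * 2^-1 :> C by field.
have e4 : 5 / 4 = 5 * (2^-1 * 2^-1) :> C by field.
rewrite e8 e4 -!rsqrt2_sqr.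
by do 6! rewrite -?scalerAl -?scalerAr ?scalerA; rewrite !mulrA.
Qed.

(** [L5] has entries only at distances 0, 2 and 4 from the diagonal. The entries
    at distance 6, which the degree of [L5] would permit, cancel. *)
Lemma barg_L5 p k : barg (weyl_L5 R) p k =
  (k%:R ^+ 3 - k%:R ^+ 2 + 7 / 2 * k%:R - 1) * p k
  + (k.+1%:R * k.+2%:R) * p k.+2 + raise (raise p) k
  - 2^-1 * (k%:R * k.+1%:R * k.+2%:R * k.+3%:R * k.+4%:R) * p k.+4
  - 2^-1 * (k%:R - 4) * raise (raise (raise (raise p))) k.
Proof.
rewrite weyl_L5E.
have bp q : barg (weyl_a R + weyl_as R) q = fun k => lower q k + raise q k.
  by apply/funext => j; rewrite bargD barg_a barg_as.
have bm q : barg (weyl_a R - weyl_as R) q = fun k => lower q k - raise q k.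
  by apply/funext => j; rewrite bargD bargN barg_a barg_as.
move: (weyl_a R + weyl_as R) (weyl_a R - weyl_as R) bp bm => x y bp bm.
rewrite !(bargD, bargN, bargZ, bargM) !bp !bm.
case: k => [|[|[|[|[|[|k]]]]]]; rewrite /lower /raise; by field.
Qed.

Definition shifted_L5 : weyl R := weyl_L5 R + (14 / 10)%:A.

Lemma weyl_starN u : weyl_star (- u) = - weyl_star u.
Proof. by rewrite -[- u]scaleN1r weyl_starZ (rmorphN1 (@conjc R)) scaleN1r. Qed.

Lemma weyl_star1 : weyl_star (1 : weyl R) = 1.
Proof.
by rewrite -[LHS]mulr1 -{2}(weyl_starK 1) -weyl_starM mulr1 weyl_starK.
Qed.

Lemma weyl_starY : weyl_star (weyl_Y R) = - weyl_Y R.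
Proof.
rewrite /weyl_Y weyl_starZ weyl_starD weyl_starN weyl_star_a weyl_star_as.
by rewrite -(fmorphV (real_complex R)) conjc_real -scalerN opprB.
Qed.

Lemma weyl_L5_herm : weyl_star (weyl_L5 R) = weyl_L5 R.
Proof.
rewrite weyl_L5_words !(weyl_starD, weyl_starN, weyl_starZ) !weyl_starM.
rewrite weyl_X_herm weyl_starY conjc_nat.
by rewrite !(mulNr, mulrN, opprK) !mulrA.
Qed.

End Operator.

(** * Boundary terms and the weighted arithmetic-geometric inequality *)

Section Estimates.
Variable R : realType.
Local Notation C := R[i].
Local Notation Re := (@complex.Re R).
Local Notation Im := (@complex.Im R).

Section Shift.
Implicit Types f : nat -> R.

Lemma raise_cvg0 f : f @ \oo --> (0 : R) -> raise f @ \oo --> (0 : R).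
Proof.
move=> f0; rewrite -(cvg_shiftn 1).
by under eq_fun do rewrite addn1.
Qed.

Lemma cvgD0 f g : f @ \oo --> (0 : R) -> g @ \oo --> (0 : R) ->
  f \+ g @ \oo --> (0 : R).
Proof. by move=> f0 g0; have := cvgD f0 g0; rewrite addr0; apply. Qed.

Lemma cvgMl0 c f : f @ \oo --> (0 : R) -> (c * f n) @[n --> \oo] --> (0 : R).
Proof.
move=> f0; have H : (c * f n) @[n --> \oo] --> c * 0 by exact: cvgMl_tmp.
by rewrite mulr0 in H.
Qed.

(** Truncated sums of a sequence and of its shift differ by one boundary term.
    This is how the two triangles of the band matrix are brought together. *)
Lemma series_raise_cvg0 f : f @ \oo --> (0 : R) ->
  (series (raise f) n - series f n) @[n --> \oo] --> (0 : R).
Proof.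
move=> f0; rewrite -(cvg_shiftn 1).
rewrite (_ : (fun n => _) = - f); last first.
  apply/funext => n; rewrite addn1 /series /= big_nat_recl //= add0r.
  by rewrite big_nat_recr //= opprD addrA subrr add0r.
have N0 : - f @ \oo --> (- 0 : R) by exact: cvgN.
by rewrite oppr0 in N0; exact: N0.
Qed.

Lemma series_raise2_cvg0 f : f @ \oo --> (0 : R) ->
  (series (raise (raise f)) n - series f n) @[n --> \oo] --> (0 : R).
Proof.
move=> f0; rewrite (_ : (fun n => _) =
  (fun n => series (raise (raise f)) n - series (raise f) n)
  \+ (fun n => series (raise f) n - series f n)); last first.
  by apply/funext => n /=; rewrite subrKA.
by apply: cvgD0; apply: series_raise_cvg0 => //; exact: raise_cvg0.
Qed.

Lemma series_raise4_cvg0 f : f @ \oo --> (0 : R) ->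
  (series (raise (raise (raise (raise f)))) n - series f n) @[n --> \oo]
    --> (0 : R).
Proof.
move=> f0; rewrite (_ : (fun n => _) =
  (fun n => series (raise (raise (raise (raise f)))) n -
            series (raise (raise f)) n)
  \+ (fun n => series (raise (raise f)) n - series f n)); last first.
  by apply/funext => n /=; rewrite subrKA.
by apply: cvgD0; apply: series_raise2_cvg0 => //; do 2! apply: raise_cvg0.
Qed.

End Shift.

Lemma seriesDE (f g : nat -> R) n :
  series (fun k => f k + g k) n = series f n + series g n.
Proof. by rewrite /series /= big_split. Qed.

Lemma seriesBE (f g : nat -> R) n :
  series (fun k => f k - g k) n = series f n - series g n.
Proof. by rewrite /series /= sumrB. Qed.

Lemma fock_domain_cvg0 (phi : nat -> C) : fock_domain R phi ->
  (k.+1%:R ^+ 3 * Normc.normc (phi k) ^+ 2) @[k --> \oo] --> (0 : R).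
Proof.
move=> D.
have w0 M : (k%:R ^+ M * Normc.normc (phi k) ^+ 2) @[k --> \oo] --> (0 : R).
  apply: cvg_series_cvg_0; apply: nnseries_is_cvg (D M) => k.
  by rewrite mulr_ge0 ?sqr_ge0.
(* (k + 1)^3 <= 4 k^3 + 4 *)
apply: (@squeeze_cvgr _ _ _ _ (fun=> 0)
  (fun k => 4 * (k%:R ^+ 3 * Normc.normc (phi k) ^+ 2) +
            4 * (k%:R ^+ 0 * Normc.normc (phi k) ^+ 2))).
- near=> k; apply/andP; split; first by rewrite mulr_ge0 ?sqr_ge0.
  rewrite expr0 mul1r mulrA -mulrDl.
  rewrite ler_wpM2r ?sqr_ge0 //; rewrite -natr1 -subr_ge0.
  rewrite (_ : _ - _ = 3 * ((k%:R - 1) ^+ 2 * (k%:R + 1))); last by ring.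
  by rewrite mulr_ge0 ?ler0n // mulr_ge0 ?sqr_ge0.
- exact: cvg_cst.
- by apply: cvgD0; apply: cvgMl0; exact: w0.
Unshelve. all: by end_near.
Qed.

Definition norm2 (z : C) : R := Re z ^+ 2 + Im z ^+ 2.

Lemma norm2_ge0 z : 0 <= norm2 z.
Proof. by rewrite addr_ge0 ?sqr_ge0. Qed.

Lemma norm2E z : z * conjc z = (norm2 z)%:C.
Proof.
case: z => x y; apply/eqP; rewrite eq_complex /norm2 /=.
by apply/andP; split; apply/eqP; ring.
Qed.

Lemma normc_norm2 z : Normc.normc z ^+ 2 = norm2 z.
Proof.
by case: z => x y; rewrite /Normc.normc sqr_sqrtr ?addr_ge0 ?sqr_ge0.
Qed.

Lemma complex_ReD (z w : C) : Re (z + w) = Re z + Re w.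
Proof. by case: z w => ? ? []. Qed.
Lemma complex_ImD (z w : C) : Im (z + w) = Im z + Im w.
Proof. by case: z w => ? ? []. Qed.
Lemma complex_ReJ (z : C) : Re (conjc z) = Re z.
Proof. by case: z. Qed.
Lemma complex_ImJ (z : C) : Im (conjc z) = - Im z.
Proof. by case: z. Qed.
Lemma complex_ReMr (r : R) (z : C) : Re (r%:C * z) = r * Re z.
Proof. by case: z => x y /=; rewrite mul0r subr0. Qed.
Lemma complex_ImMr (r : R) (z : C) : Im (r%:C * z) = r * Im z.
Proof. by case: z => x y /=; rewrite mul0r addr0. Qed.

Lemma conjcMr (r : R) (z : C) : conjc (r%:C * z) = r%:C * conjc z.
Proof. by rewrite (rmorphM (@conjc R)) /= oppr0. Qed.

Lemma conjcMJ (z w : C) : conjc (z * conjc w) = w * conjc z.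
Proof. by rewrite (rmorphM (@conjc R)) /= conjcK mulrC. Qed.

(** The bounds on real and imaginary part of one off-diagonal entry [c]: the
    square of the right-hand side exceeds that of the left-hand side by
    the square of [(A |z|^2 - B |w|^2) / 2] plus a nonnegative multiple of the
    square of the other part. *)
Lemma amgm (A B c : R) (z w : C) : 0 <= A -> 0 <= B -> c ^+ 2 = A * B ->
  (`|c * Re (w * conjc z)| <= 2^-1 * (A * norm2 z + B * norm2 w)) /\
  (`|c * Im (w * conjc z)| <= 2^-1 * (A * norm2 z + B * norm2 w)).
Proof.
move=> A0 B0 cAB.
have H (r i : R) : r ^+ 2 + i ^+ 2 = norm2 z * norm2 w ->
    `|c * r| <= 2^-1 * (A * norm2 z + B * norm2 w).
  move=> e; have z0 := norm2_ge0 z; have w0 := norm2_ge0 w.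
  have e2 : (c * r) ^+ 2 = A * B * (norm2 z * norm2 w - i ^+ 2).
    by rewrite exprMn cAB -e addrK.
  have p0 : 0 <= 2^-1 * (A * norm2 z + B * norm2 w).
    by apply: mulr_ge0; rewrite ?invr_ge0 ?ler0n // addr_ge0 // mulr_ge0.
  rewrite -ler_sqr ?nnegrE // real_normK ?num_real // e2 -subr_ge0.
  rewrite (_ : _ - _ =
    (2^-1 * (A * norm2 z - B * norm2 w)) ^+ 2 + A * B * i ^+ 2).
    by rewrite addr_ge0 ?sqr_ge0 // mulr_ge0 ?sqr_ge0 // mulr_ge0.
  by field.
case: z w H => u v [x y] H; split.
  apply: (H _ (complex.Im ((x +i* y) * conjc (u +i* v)))).
  by rewrite /norm2 /=; ring.
apply: (H _ (complex.Re ((x +i* y) * conjc (u +i* v)))).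
by rewrite /norm2 /=; ring.
Qed.

End Estimates.

(** * Positivity in the Fock-Bargmann representation *)

Section Weights.
Variable R : realType.
Local Notation C := R[i].

Definition sfact (k : nat) : R := Num.sqrt k`!%:R.

Lemma sfactS k : sfact k.+1 = Num.sqrt k.+1%:R * sfact k.
Proof. by rewrite /sfact factS natrM sqrtrM. Qed.

Lemma sfact_gt0 k : 0 < sfact k.
Proof. by rewrite sqrtr_gt0 ltr0n fact_gt0. Qed.

Lemma sfact_sqr k : sfact k ^+ 2 = k`!%:R.
Proof. by rewrite sqr_sqrtr. Qed.

Lemma fock_barg (u : weyl R) (psi : nat -> C) :
  fock u (fun k => (sfact k)%:C * psi k) =
  (fun k => (sfact k)%:C * barg u psi k).
Proof.
rewrite /fock /barg /act.
elim: (weyl_term u) psi => [||c|x IHx y IHy|x IHx y IHy] psi /=.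
- apply/funext => k; rewrite /fock_a /lower sfactS rmorphM /= mulrA mulrA.
  rewrite -rmorphM /= -expr2 sqr_sqrtr ?ler0n // rmorph_nat; ring.
- apply/funext => -[|k]; rewrite /fock_as /= ?mulr0 // sfactS rmorphM /=; ring.
- by apply/funext => k; ring.
- by rewrite IHx IHy; apply/funext => k; ring.
- by rewrite IHy IHx.
Qed.

(** The entry between positions [k] and [k + 2] is bounded by weights [left2 k]
    at [k] and [right2 k] at [k + 2]; likewise for [left4], [right4] and the
    positions [k] and [k + 4]. The general values of [left4] and [right4] come
    from the trial ratio [k / (k + 3)] in
    [k (k + 1) (k + 3) / 2 * ratio] and [k (k + 2) (k + 4) / 2 / ratio]; those
    of [left2] and [right2] from the ratio 1. For [k >= 5] they leave the margin
    [k / 2 - 3 / 5]. At 0 the diagonal entry is only [2 / 5], which forces a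
    small [left2 0] and so a large [right2 0]; the exceptional values spread the
    resulting excess over the positions 2, 4, 6 and 8, where it fits. The entry
    between 0 and 4 is 0. *)
Definition left2 (k : nat) : R := match k with
  | 0 => 2 / 5 | 2 => 3 / 4 | 4 => 25 / 4 | 6 => 63 / 10 | _ => k%:R + 1 end.
Definition right2 (k : nat) : R := match k with
  | 0 => 5 | 2 => 16 | 4 => 24 / 5 | 6 => 80 / 9 | _ => k%:R + 2 end.
Definition left4 (k : nat) : R :=
  if k is 2 then 45 / 8 else 2^-1 * k%:R ^+ 2 * (k%:R + 1).
Definition right4 (k : nat) : R := match k with
  | 0 => 0 | 2 => 64 | _ => 2^-1 * (k%:R + 2) * (k%:R + 3) * (k%:R + 4) end.
Definition diag_entry (k : nat) : R :=
  k%:R ^+ 3 - k%:R ^+ 2 + 7 / 2 * k%:R + 2 / 5.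

Lemma left2_ge0 k : 0 <= left2 k.
Proof. by case: k => [|[|[|[|[|[|[|k]]]]]]]; rewrite /left2; try lra;
  rewrite addr_ge0 ?ler0n ?ler01.
Qed.

Lemma right2_ge0 k : 0 <= right2 k.
Proof. by case: k => [|[|[|[|[|[|[|k]]]]]]]; rewrite /right2; try lra;
  rewrite addr_ge0 ?ler0n ?ler01.
Qed.

Lemma left4_ge0 k : 0 <= left4 k.
Proof. by case: k => [|[|[|k]]]; rewrite /left4; try lra. Qed.

Lemma right4_ge0 k : 0 <= right4 k.
Proof. by case: k => [|[|[|k]]]; rewrite /right4; try lra. Qed.

Lemma left2_right2 k : left2 k * right2 k = (k%:R + 1) * (k%:R + 2).
Proof. by case: k => [|[|[|[|[|[|[|k]]]]]]]; rewrite /left2 /right2; field. Qed.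

Lemma left4_right4 k : left4 k * right4 k =
  4^-1 * k%:R ^+ 2 * (k%:R + 1) * (k%:R + 2) * (k%:R + 3) * (k%:R + 4).
Proof. by case: k => [|[|[|k]]]; rewrite /left4 /right4; field. Qed.

(** The Schur test: at every position the weights of the adjacent entries stay
    below the diagonal entry. *)
Lemma dominance (m : nat -> R) k : 0 <= m k ->
  left2 k * m k + raise (raise (fun j => right2 j * m j.+2)) k +
  (left4 k * m k +
   raise (raise (raise (raise (fun j => right4 j * m j.+4)))) k) <=
  diag_entry k * m k.
Proof.
rewrite /diag_entry /raise.
case: k => [|[|[|[|[|[|[|[|[|[|k]]]]]]]]]];
  rewrite /left2 /right2 /left4 /right4 => mk; try lra.
set x := m _ in mk *; set t : R := k%:R.
have t0 : 0 <= t by exact: ler0n.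
have e10 : k.+2.+4.+4%:R = t + 10 :> R by rewrite /t; ring.
have e8 : k.+4.+4%:R = t + 8 :> R by rewrite /t; ring.
have e6 : k.+2.+4%:R = t + 6 :> R by rewrite /t; ring.
rewrite e10 e8 e6 -subr_ge0.
rewrite (_ : _ - _ = (2^-1 * (t + 10) - 6 / 10) * x); last by field.
by rewrite mulr_ge0 //; lra.
Qed.

Lemma left2_le k : left2 k <= 8 * (k%:R + 1) ^+ 3.
Proof.
have t0 : 0 <= k%:R :> R by exact: ler0n.
by move: t0; case: k => [|[|[|[|[|[|[|k]]]]]]]; rewrite /left2 => t0; try lra;
  have t2 := mulr_ge0 t0 t0; have t3 := mulr_ge0 t2 t0; lra.
Qed.

Lemma right2_le k : right2 k <= 8 * (k.+2%:R + 1) ^+ 3.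
Proof.
rewrite -[k.+2]addn2 natrD; have t0 : 0 <= k%:R :> R by exact: ler0n.
by move: t0; case: k => [|[|[|[|[|[|[|k]]]]]]]; rewrite /right2 => t0; try lra;
  have t2 := mulr_ge0 t0 t0; have t3 := mulr_ge0 t2 t0; lra.
Qed.

Lemma left4_le k : left4 k <= 8 * (k%:R + 1) ^+ 3.
Proof.
have t0 : 0 <= k%:R :> R by exact: ler0n.
by move: t0; case: k => [|[|[|k]]]; rewrite /left4 => t0; try lra;
  have t2 := mulr_ge0 t0 t0; have t3 := mulr_ge0 t2 t0; lra.
Qed.

Lemma right4_le k : right4 k <= 8 * (k.+4%:R + 1) ^+ 3.
Proof.
rewrite -[k.+4]addn4 natrD; have t0 : 0 <= k%:R :> R by exact: ler0n.
by move: t0; case: k => [|[|[|k]]]; rewrite /right4 => t0; try lra;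
  have t2 := mulr_ge0 t0 t0; have t3 := mulr_ge0 t2 t0; lra.
Qed.

End Weights.

Section Positivity.
Variable R : realType.
Local Notation C := R[i].
Local Notation Re := (@complex.Re R).
Local Notation Im := (@complex.Im R).

Section Vector.
Variable psi : nat -> C.

Let phi k := (sfact R k)%:C * psi k.
Hypothesis Dphi : fock_domain R phi.

Let n k : R := norm2 (phi k).
Let t k : C := k.+2`!%:R%:C * (psi k.+2 * conjc (psi k)).
Let s k : C := (- 2^-1 * k%:R * k.+4`!%:R)%:C * (psi k.+4 * conjc (psi k)).

Let nE k : n k = k`!%:R * norm2 (psi k).
Proof.
by rewrite /n -!normc_norm2 normc_real sfact_sqr.
Qed.

Let G k : C := fock (shifted_L5 R) phi k * conjc (phi k).

(** The summand of the quadratic form at [k] is the diagonal term plus the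
    entries above the diagonal, [t] and [s], plus the conjugates of the same
    sequences shifted by 2 and 4. *)
Lemma energy_termE k :
  G k = (diag_entry R k * n k)%:C + t k + conjc (raise (raise t) k)
  + s k + conjc (raise (raise (raise (raise s))) k).
Proof.
rewrite /G /phi fock_barg.
have -> : barg (shifted_L5 R) psi k = barg (weyl_L5 R) psi k + 14 / 10 * psi k.
  by rewrite /shifted_L5 bargD bargZ barg1.
have -> : conjc ((sfact R k)%:C * psi k) = (sfact R k)%:C * conjc (psi k).
  by rewrite conjcMr.
rewrite [LHS](_ : _ = ((sfact R k)^+2)%:C *
  ((barg (weyl_L5 R) psi k + 14 / 10 * psi k) * conjc (psi k))).
  2: by rewrite rmorphXn /=; ring.
rewrite sfact_sqr nE !rmorphM /= -norm2E barg_L5.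
rewrite /diag_entry.
case: k => [|[|[|[|k]]]]; rewrite /t /s /raise ?conjc0 ?conjcMr ?conjcMJ.
all: rewrite ?factS ?fact0 ?natrM.
all: by field.
Qed.

Let n_ge0 k : 0 <= n k.
Proof. exact: norm2_ge0. Qed.

Let t_le k :
  `|Re (t k)| <= 2^-1 * (left2 R k * n k + right2 R k * n k.+2) /\
  `|Im (t k)| <= 2^-1 * (left2 R k * n k + right2 R k * n k.+2).
Proof.
rewrite !nE !mulrA /t complex_ReMr complex_ImMr; apply: amgm.
- by rewrite mulr_ge0 ?left2_ge0.
- by rewrite mulr_ge0 ?right2_ge0.
- by rewrite mulrACA left2_right2 !factS !natrM; ring.
Qed.

Let s_le k :
  `|Re (s k)| <= 2^-1 * (left4 R k * n k + right4 R k * n k.+4) /\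
  `|Im (s k)| <= 2^-1 * (left4 R k * n k + right4 R k * n k.+4).
Proof.
rewrite !nE !mulrA /s complex_ReMr complex_ImMr; apply: amgm.
- by rewrite mulr_ge0 ?left4_ge0.
- by rewrite mulr_ge0 ?right4_ge0.
- by rewrite mulrACA left4_right4 !factS !natrM; field.
Qed.

Let m k : R := (k%:R + 1) ^+ 3 * n k.

Let m0 : m @ \oo --> (0 : R).
Proof.
have := fock_domain_cvg0 Dphi.
by under eq_fun do rewrite normc_norm2 -natr1.
Qed.

Let m_ge0 k : 0 <= m k.
Proof. by rewrite mulr_ge0 // exprn_ge0 // addr_ge0 ?ler0n. Qed.

Let small (f : nat -> R) :
  (forall k, `|f k| <= 8 * m k + (8 * m k.+2 + 8 * m k.+4)) ->
  f @ \oo --> (0 : R).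
Proof.
move=> fm; apply: norm_cvg0.
apply: (@squeeze_cvgr _ _ _ _ (fun=> 0)
  ((fun k => 8 * m k) \+ ((fun k => 8 * m k.+2) \+ (fun k => 8 * m k.+4)))).
- by near=> k; rewrite normr_ge0 fm.
- exact: cvg_cst.
- apply: cvgD0; first exact: cvgMl0.
  apply: cvgD0; apply: cvgMl0.
    by have := m0; rewrite -(cvg_shiftn 2); under eq_fun do rewrite addn2.
  by have := m0; rewrite -(cvg_shiftn 4); under eq_fun do rewrite addn4.
Unshelve. all: by end_near.
Qed.

Let left2_m k : left2 R k * n k <= 8 * m k.
Proof. by rewrite /m mulrA ler_wpM2r ?left2_le. Qed.
Let right2_m k : right2 R k * n k.+2 <= 8 * m k.+2.
Proof. by rewrite /m mulrA ler_wpM2r ?right2_le. Qed.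
Let left4_m k : left4 R k * n k <= 8 * m k.
Proof. by rewrite /m mulrA ler_wpM2r ?left4_le. Qed.
Let right4_m k : right4 R k * n k.+4 <= 8 * m k.+4.
Proof. by rewrite /m mulrA ler_wpM2r ?right4_le. Qed.

Let t0 : (fun k => Re (t k)) @ \oo --> (0 : R) /\
         (fun k => Im (t k)) @ \oo --> (0 : R).
Proof.
split; apply: small => k; have [t1 t2] := t_le k;
  have := left2_m k; have := right2_m k; have := m_ge0 k; have := m_ge0 k.+2;
  have := m_ge0 k.+4; lra.
Qed.

Let s0 : (fun k => Re (s k)) @ \oo --> (0 : R) /\
         (fun k => Im (s k)) @ \oo --> (0 : R).
Proof.
split; apply: small => k; have [s1 s2] := s_le k;
  have := left4_m k; have := right4_m k; have := m_ge0 k; have := m_ge0 k.+2;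
  have := m_ge0 k.+4; lra.
Qed.

Let b2 k := right2 R k * n k.+2.
Let b4 k := right4 R k * n k.+4.

Let b20 : b2 @ \oo --> (0 : R).
Proof.
apply: small => k; rewrite ger0_norm ?mulr_ge0 ?right2_ge0 //.
by have := right2_m k; rewrite /b2; have := m_ge0 k; have := m_ge0 k.+4; lra.
Qed.

Let b40 : b4 @ \oo --> (0 : R).
Proof.
apply: small => k; rewrite ger0_norm ?mulr_ge0 ?right4_ge0 //.
by have := right4_m k; rewrite /b4; have := m_ge0 k; have := m_ge0 k.+2; lra.
Qed.

Let tr k := Re (t k).
Let ti k := Im (t k).
Let sr k := Re (s k).
Let si k := Im (s k).

Let ReG k : Re (G k) = diag_entry R k * n k + tr k + raise (raise tr) k + sr k +
  raise (raise (raise (raise sr))) k.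
Proof.
rewrite energy_termE !complex_ReD !complex_ReJ; congr (_ + _ + _ + _ + _).
  by case: k => [|[|k]].
by case: k => [|[|[|[|k]]]].
Qed.

Let ImG k : Im (G k) = (ti k - raise (raise ti) k) +
  (si k - raise (raise (raise (raise si))) k).
Proof.
rewrite energy_termE !complex_ImD !complex_ImJ add0r -addrA.
congr (_ - _ + (_ - _)).
  by case: k => [|[|k]].
by case: k => [|[|[|[|k]]]].
Qed.

(** Up to boundary terms, the sums over [t] and over its shift have conjugate
    values, so the imaginary part vanishes in the limit and the real part is a
    sum of diagonal terms and twice the real parts of [t] and [s]. Replacing
    these by their lower bounds and shifting the weights [right2], [right4] back
    into place leaves [dominance]. *)
Lemma energy_ge0 : 0 <= inner (fock (shifted_L5 R) phi) phi.
Proof.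
have Du : fock_domain R (fock (shifted_L5 R) phi) by exact: fock_domain_fock.
have [cR cI] := is_cvg_inner Du Dphi.
rewrite lecE /=; apply/andP; split.
  apply/eqP/cvg_lim => //.
  rewrite (_ : series _ =
    (fun k => - (series (raise (raise ti)) k - series ti k)) \+
    (fun k => - (series (raise (raise (raise (raise si)))) k - series si k)));
    last first.
    apply/funext => k /=; rewrite !opprB -!seriesBE -seriesDE.
    by congr (series _ k); apply/funext => j; rewrite -ImG.
  apply: cvgD0.
    by rewrite -oppr0; apply: cvgN; apply: series_raise2_cvg0; case: t0.
  by rewrite -oppr0; apply: cvgN; apply: series_raise4_cvg0; case: s0.
(* The lower bound for the partial sums consists of boundary terms only. *)
pose d2 f k := series (raise (raise f)) k - series f k : R.
pose d4 f k := series (raise (raise (raise (raise f)))) k - series f k : R.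
have e0 : (d2 b2 \+ d2 tr) \+ (d4 b4 \+ d4 sr) @ \oo --> (0 : R).
  have [tr0 _] := t0; have [sr0 _] := s0.
  by apply: cvgD0; apply: cvgD0;
    [exact: series_raise2_cvg0|exact: series_raise2_cvg0
    |exact: series_raise4_cvg0|exact: series_raise4_cvg0].
rewrite -(cvg_lim (@Rhausdorff R) e0); apply: ler_lim => //.
  by apply/cvg_ex; exists 0.
near=> N => /=; rewrite /d2 /d4 -!seriesBE -!seriesDE; apply: ler_sum => k _.
have := dominance (n_ge0 k); rewrite -/b2 -/b4.
have [t1 _] := t_le k; have [s1 _] := s_le k.
move: t1 s1; rewrite !ler_norml => /andP[t1 _] /andP[s1 _] dom.
rewrite -/(G k) ReG.
move: t1 s1 dom; rewrite -/(b2 k) -/(b4 k) -/(tr k) -/(sr k); lra.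
Unshelve. all: by end_near.
Qed.

End Vector.

Lemma shifted_L5_Aplus : Aplus R (shifted_L5 R).
Proof.
split.
  rewrite /weyl_herm /shifted_L5 /= weyl_starD weyl_starZ weyl_star1.
  have -> : 14 / 10 = (14 / 10 : R)%:C :> C.
    by rewrite fmorph_div /= !rmorph_nat.
  by rewrite conjc_real weyl_L5_herm.
move=> phi Dphi; pose psi k := (sfact R k)^-1%:C * phi k.
have phiE : phi = fun k => (sfact R k)%:C * psi k.
  apply/funext => k; rewrite /psi mulrA -rmorphM /= mulfV ?mul1r //.
  by rewrite gt_eqF ?sfact_gt0.
by move: Dphi; rewrite phiE; exact: energy_ge0.
Qed.

End Positivity.

(** * Degree filtration by words in X and Y *)

Section Filtration.
Variable R : rcfType.
Local Notation C := R[i].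
Implicit Types (u v : weyl R).
Local Notation X := (weyl_X R).
Local Notation Y := (weyl_Y R).

Lemma weyl_YXE : Y * X = X * Y + 1.
Proof. by rewrite -(weyl_YX R) addrC subrK. Qed.

(** The elements of degree at most [n] in [X] and [Y], generated by left
    multiplications; a spanning family then follows by recursion on [n]. *)
Fixpoint filt (n : nat) : set (weyl R) :=
  if n is n'.+1 then
    [set u | exists v w z, [/\ filt n' v, filt n' w, filt n' z
                             & u = X * v + Y * w + z]]
  else [set u | exists c : C, u = c%:A].

Lemma filtZD n c u v : filt n u -> filt n v -> filt n (c *: u + v).
Proof.
elim: n c u v => [|n IH] c u v /=.
  move=> [x ->] [y ->]; exists (c * x + y).
  by rewrite scalerA -scalerDl.
move=> [u1 [u2 [u3 [f1 f2 f3 ->]]]] [v1 [v2 [v3 [g1 g2 g3 ->]]]].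
exists (c *: u1 + v1), (c *: u2 + v2), (c *: u3 + v3); split; try exact: IH.
rewrite !mulrDr !scalerDr -!scalerAr.
by rewrite addrACA; congr (_ + _); rewrite addrACA.
Qed.

Lemma filt0 n : filt n 0.
Proof.
elim: n => [|n IH] /=; first by exists 0; rewrite scale0r.
by exists 0, 0, 0; rewrite !mulr0 !addr0; split.
Qed.

Lemma filtD n u v : filt n u -> filt n v -> filt n (u + v).
Proof. by move=> fu fv; rewrite -[u]scale1r; apply: filtZD. Qed.

Lemma filtZ n c u : filt n u -> filt n (c *: u).
Proof. by move=> fu; rewrite -[_ *: _]addr0; apply: filtZD fu (filt0 n). Qed.

Lemma filtXM n u : filt n u -> filt n.+1 (X * u).
Proof.
by move=> fu; exists u, 0, 0; rewrite mulr0 !addr0; split => //; exact: filt0.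
Qed.

Lemma filtYM n u : filt n u -> filt n.+1 (Y * u).
Proof.
move=> fu; exists 0, u, 0; rewrite mulr0 add0r addr0.
by split => //; exact: filt0.
Qed.

Lemma filtS n u : filt n u -> filt n.+1 u.
Proof.
by move=> fu; exists 0, 0, u; rewrite !mulr0 !add0r; split => //; exact: filt0.
Qed.

Lemma filt_le n m u : (n <= m)%N -> filt n u -> filt m u.
Proof. by move=> /subnK <-; elim: (m - n)%N => // k IH /IH; exact: filtS. Qed.

Lemma weyl_aE : weyl_a R = rsqrt2 R *: (X + Y).
Proof.
rewrite /weyl_X /weyl_Y -/(rsqrt2 R) scalerDr !scalerA rsqrt2_sqr -scalerDr.
move: (weyl_a R) (weyl_as R) => a b; rewrite addrACA subrr addr0.
by rewrite -mulr2n -[a *+ 2]scaler_nat scalerA mulVf ?scale1r // pnatr_eq0.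
Qed.

Lemma weyl_asE : weyl_as R = rsqrt2 R *: (X - Y).
Proof.
rewrite /weyl_X /weyl_Y -/(rsqrt2 R) scalerBr !scalerA rsqrt2_sqr -scalerBr.
move: (weyl_a R) (weyl_as R) => a b; rewrite opprB addrC addrA subrK.
by rewrite -mulr2n -[b *+ 2]scaler_nat scalerA mulVf ?scale1r // pnatr_eq0.
Qed.

Lemma filt_aM n u : filt n u -> filt n.+1 (weyl_a R * u).
Proof.
move=> fu; rewrite weyl_aE -scalerAl mulrDl.
by apply/filtZ/filtD; [exact: filtXM|exact: filtYM].
Qed.

Lemma filt_asM n u : filt n u -> filt n.+1 (weyl_as R * u).
Proof.
move=> fu; rewrite weyl_asE -scalerAl mulrBl -scaleN1r.
by apply/filtZ/filtD; [exact: filtXM|apply/filtZ/filtYM].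
Qed.

Lemma filt_aXM j n u : filt n u -> filt (j + n) (weyl_a R ^+ j * u).
Proof.
move=> fu; elim: j => [|j IH]; first by rewrite mul1r.
by rewrite exprS -mulrA addSn; exact: filt_aM.
Qed.

Lemma filt_asXM j n u : filt n u -> filt (j + n) (weyl_as R ^+ j * u).
Proof.
move=> fu; elim: j => [|j IH]; first by rewrite mul1r.
by rewrite exprS -mulrA addSn; exact: filt_asM.
Qed.

Lemma filt1 : filt 0 1.
Proof. by exists 1; rewrite scale1r. Qed.

(** The number operator has degree 2, and [size p] is one more than the degree
    of [p]. *)
Lemma filt_hornerM (p : {poly C}) n u : filt n u ->
  filt ((size p).-1.*2 + n) (horner_alg (weyl_N R) p * u).
Proof.
elim/poly_ind: p n u => [|p c IH] n u fu.
  by rewrite rmorph0 mul0r; exact: filt0.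
rewrite rmorphD rmorphM /= horner_algC horner_algX mulrDl -mulrA.
have [->|p0] := eqVneq p 0.
  rewrite rmorph0 !mul0r add0r -scalerAl mul1r add0r.
  by apply/filtZ; apply: filt_le fu; exact: leq_addl.
have -> : size (p * 'X + c%:P) = (size p).+1.
  rewrite size_polyDl; first by rewrite size_mulX.
  rewrite size_mulX // (leq_ltn_trans (size_polyC_leq1 _)) //.
  by rewrite ltnS lt0n size_poly_eq0.
apply: filtD.
  rewrite (_ : (_ + n = (size p).-1.*2 + n.+2)%N); last first.
    have : size p != 0%N by rewrite size_poly_eq0.
    by case: (size p) => // k _; rewrite doubleS !addSn !addnS.
  by apply: IH; rewrite /weyl_N -mulrA; apply/filt_asM/filt_aM.
by rewrite -scalerAl mul1r; apply/filtZ; apply: filt_le fu; exact: leq_addl.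
Qed.

(** Normally ordered words listed by degree: the first 1, 3, 6, 10 of them span
    the elements of degree at most 0, 1, 2, 3. *)
Definition mon (i : nat) : weyl R := match i with
  | 0 => 1 | 1 => X | 2 => Y | 3 => X * X | 4 => X * Y | 5 => Y * Y
  | 6 => X * (X * X) | 7 => X * (X * Y) | 8 => X * (Y * Y)
  | _ => Y * (Y * Y) end.

Definition spanned n u := exists c : nat -> C, u = \sum_(i < n) c i *: mon i.

Lemma spannedD n u v : spanned n u -> spanned n v -> spanned n (u + v).
Proof.
move=> [c ->] [d ->]; exists (fun i => c i + d i).
by rewrite -big_split /=; apply: eq_bigr => i _; rewrite scalerDl.
Qed.

Lemma spannedZ n a u : spanned n u -> spanned n (a *: u).
Proof.
move=> [c ->]; exists (fun i => a * c i).
by rewrite scaler_sumr; apply: eq_bigr => i _; rewrite scalerA.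
Qed.

Lemma spanned_mon n i : (i < n)%N -> spanned n (mon i).
Proof.
move=> lt_in; exists (fun j => (j == i)%:R).
rewrite (bigD1 (Ordinal lt_in)) //= eqxx scale1r big1 ?addr0 // => j.
by rewrite -val_eqE /= => /negbTE ->; rewrite scale0r.
Qed.

Lemma spannedM n m (x u : weyl R) : spanned n u ->
  (forall i, (i < n)%N -> spanned m (x * mon i)) -> spanned m (x * u).
Proof.
move=> [c ->] xm; rewrite mulr_sumr.
apply: big_ind => [|v w|i _].
- by exists (fun=> 0); rewrite big1 // => i _; rewrite scale0r.
- exact: spannedD.
- by rewrite -scalerAr; apply/spannedZ/xm.
Qed.

Lemma spanned_le n m u : (n <= m)%N -> spanned n u -> spanned m u.
Proof.
move=> nm su; rewrite -[u]mul1r; apply: spannedM su _ => i lt_in.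
by rewrite mul1r; apply: spanned_mon; exact: leq_trans nm.
Qed.

Lemma filt_step n k m : (k <= m)%N -> (forall u, filt n u -> spanned k u) ->
  (forall i, (i < k)%N -> spanned m (X * mon i)) ->
  (forall i, (i < k)%N -> spanned m (Y * mon i)) ->
  forall u, filt n.+1 u -> spanned m u.
Proof.
move=> km fs sX sY _ [v [w [z [/fs sv /fs sw /fs sz ->]]]].
apply: spannedD; last exact: spanned_le sz.
by apply: spannedD; [exact: spannedM sv _|exact: spannedM sw _].
Qed.

Lemma filt0_spanned u : filt 0 u -> spanned 1 u.
Proof. by move=> [c ->]; exists (fun=> c); rewrite big_ord1. Qed.

Lemma filt1_spanned u : filt 1 u -> spanned 3 u.
Proof.
apply: filt_step filt0_spanned _ _ _ => // -[|//] _; rewrite /= mulr1.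
  exact: (@spanned_mon 3 1).
exact: (@spanned_mon 3 2).
Qed.

Lemma filt2_spanned u : filt 2 u -> spanned 6 u.
Proof.
apply: filt_step filt1_spanned _ _ _ => // -[|[|[|//]]] _; rewrite /= ?mulr1.
- exact: (@spanned_mon 6 1).
- exact: (@spanned_mon 6 3).
- exact: (@spanned_mon 6 4).
- exact: (@spanned_mon 6 2).
- rewrite weyl_YXE; apply: spannedD; first exact: (@spanned_mon 6 4).
  exact: (@spanned_mon 6 0).
- exact: (@spanned_mon 6 5).
Qed.

Lemma filt3_spanned u : filt 3 u -> spanned 10 u.
Proof.
apply: filt_step filt2_spanned _ _ _ => // -[|[|[|[|[|[|//]]]]]] _;
  rewrite /= ?mulr1.
- exact: (@spanned_mon 10 1).
- exact: (@spanned_mon 10 3).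
- exact: (@spanned_mon 10 4).
- exact: (@spanned_mon 10 6).
- exact: (@spanned_mon 10 7).
- exact: (@spanned_mon 10 8).
- exact: (@spanned_mon 10 2).
- rewrite weyl_YXE; apply: spannedD; first exact: (@spanned_mon 10 4).
  exact: (@spanned_mon 10 0).
- exact: (@spanned_mon 10 5).
- rewrite mulrA weyl_YXE mulrDl mul1r -mulrA weyl_YXE mulrDr mulr1.
  apply: spannedD; last exact: (@spanned_mon 10 1).
  by apply: spannedD; [exact: (@spanned_mon 10 7)|exact: (@spanned_mon 10 1)].
- rewrite mulrA weyl_YXE mulrDl mul1r -mulrA.
  by apply: spannedD; [exact: (@spanned_mon 10 8)|exact: (@spanned_mon 10 2)].
- exact: (@spanned_mon 10 9).
Qed.

End Filtration.

(** * Lexicographic positivity *)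

Section Lex.
Variable R : rcfType.
Local Notation C := R[i].
Implicit Types (u v g : weyl R) (p q : nat -> C).
Local Notation X := (weyl_X R).
Local Notation Y := (weyl_Y R).

Definition delta (n : nat) : nat -> C := fun k => (k == n)%:R.

(** Matrix elements on monomials of [C[x]]. [mel 0 m] is the coefficient of
    [X^m] in the normally ordered expansion, and [mel n 0] is [n!] times that
    of [Y^n]. *)
Definition mel (n m : nat) (u : weyl R) : C := schr u (delta n) m.

Lemma melD n m u v : mel n m (u + v) = mel n m u + mel n m v.
Proof. exact: schrD. Qed.

Lemma melZ n m c u : mel n m (c *: u) = c * mel n m u.
Proof. exact: schrZ. Qed.

Lemma mel0 n m : mel n m 0 = 0.
Proof. by rewrite -(scale0r 0) melZ mul0r. Qed.

(** A linear functional on normally ordered coefficients that is nonnegative on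
    the squares of combinations of [1, X, Y, XY, X^2 Y, X Y^2] and takes the
    value [c - 23/16] on [L5 + c]. It is a rational, nearly optimal solution of
    the semidefinite program dual to writing [L5 + c] as a sum of squares; the
    ten weights express it in matrix elements. *)
Definition ell u : C :=
  25 / 16 * mel 0 0 u + 11 / 64 * mel 0 2 u - 9 / 16 * mel 1 1 u
  - 571 / 128 * mel 2 0 u + 3 / 32 * mel 1 3 u - 1 / 16 * mel 2 2 u
  + 111 / 64 * mel 3 1 u - 9 / 64 * mel 2 4 u + 1 / 16 * mel 3 3 u
  - 77 / 256 * mel 4 2 u.

Lemma ellD u v : ell (u + v) = ell u + ell v.
Proof. by rewrite /ell !melD; ring. Qed.

Lemma ellZ c u : ell (c *: u) = c * ell u.
Proof. by rewrite /ell !melZ; ring. Qed.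

Lemma ell0 : ell 0 = 0.
Proof. by rewrite -(scale0r 0) ellZ mul0r. Qed.

(** The successive tests: the later ones apply only to elements on which the
    earlier ones give 0. The functional [ell] is designed for the squares
    without [X^3], [Y^3], [X^2] and [Y^2]; the first four tests exclude these
    words. The sign of the second test is that of
    [(Y^3)^* Y^3 = - Y^6]. *)
Definition lex_ge0 u : Prop :=
  [/\ 0 <= mel 0 6 u, mel 6 0 u <= 0
    & mel 0 6 u = 0 -> mel 6 0 u = 0 ->
      [/\ 0 <= mel 0 4 u, 0 <= mel 4 0 u
        & mel 0 4 u = 0 -> mel 4 0 u = 0 -> 0 <= ell u]].

Lemma lex_ge00 : lex_ge0 0.
Proof. by split; rewrite ?mel0 // => _ _; split; rewrite ?mel0 ?ell0. Qed.

(** If a sum of nonnegative values is 0, each of them is 0; so the condition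
    under which a later test applies to the sum passes to both summands. *)
Lemma lex_ge0D u v : lex_ge0 u -> lex_ge0 v -> lex_ge0 (u + v).
Proof.
move=> [u1 u2 u3] [v1 v2 v3]; split; first by rewrite melD addr_ge0.
  by rewrite melD -oppr_ge0 opprD addr_ge0 ?oppr_ge0.
rewrite !melD.
move=> /eqP; rewrite paddr_eq0 // => /andP[/eqP ux /eqP vx].
move=> /eqP; rewrite -oppr_eq0 opprD paddr_eq0 ?oppr_ge0 // !oppr_eq0.
move=> /andP[/eqP uy /eqP vy].
have [u4 u5 u6] := u3 ux uy; have [v4 v5 v6] := v3 vx vy.
split; [exact: addr_ge0|exact: addr_ge0|].
move=> /eqP; rewrite paddr_eq0 // => /andP[/eqP ux4 /eqP vx4].
move=> /eqP; rewrite paddr_eq0 // => /andP[/eqP uy4 /eqP vy4].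
by rewrite ellD; apply: addr_ge0; [exact: u6|exact: v6].
Qed.

Lemma lex_ge0Z c u : 0 <= c -> lex_ge0 u -> lex_ge0 (c *: u).
Proof.
move=> c0 [u1 u2 u3]; have [->|cn0] := eqVneq c 0.
  by rewrite scale0r; exact: lex_ge00.
split; first by rewrite melZ mulr_ge0.
  by rewrite melZ mulr_ge0_le0.
rewrite !melZ; move=> /eqP; rewrite mulf_eq0 (negbTE cn0) /= => /eqP ux.
move=> /eqP; rewrite mulf_eq0 (negbTE cn0) /= => /eqP uy.
have [u4 u5 u6] := u3 ux uy; split; [exact: mulr_ge0|exact: mulr_ge0|].
move=> /eqP; rewrite mulf_eq0 (negbTE cn0) /= => /eqP ux4.
move=> /eqP; rewrite mulf_eq0 (negbTE cn0) /= => /eqP uy4.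
by rewrite ellZ; apply: mulr_ge0; [|exact: u6].
Qed.

Lemma ell_shifted : ell (shifted_L5 R) = - (3 / 80).
Proof.
rewrite /shifted_L5 weyl_L5_words /ell !melD !melZ /mel.
rewrite !(schrM, schr_X, schr_Y, schr1, schrD, schrN, schrZ).
rewrite /lower /raise /delta /=.
by field.
Qed.

Lemma mel_shifted : [/\ mel 0 6 (shifted_L5 R) = 0,
  mel 6 0 (shifted_L5 R) = 0, mel 0 4 (shifted_L5 R) = 0 &
  mel 4 0 (shifted_L5 R) = 0].
Proof.
rewrite /shifted_L5 weyl_L5_words /mel.
by split; rewrite !(schrM, schr_X, schr_Y, schr1, schrD, schrN, schrZ);
  rewrite /lower /raise /delta /=; ring.
Qed.

Lemma not_lex_shifted : ~ lex_ge0 (shifted_L5 R).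
Proof.
have [x6 y6 x4 y4] := mel_shifted; move=> [_ _ /(_ x6 y6)[_ _ /(_ x4 y4)]].
rewrite ell_shifted oppr_ge0 => /le_gtF/negP; apply.
by rewrite divr_gt0 ?ltr0n.
Qed.

Definition cubic (c : nat -> C) : weyl R := \sum_(i < 10) c i *: mon R i.

Lemma schr_cubic c p k : schr (cubic c) p k =
  c 0 * p k + c 1 * raise p k + c 2 * lower p k + c 3 * raise (raise p) k
  + c 4 * raise (lower p) k + c 5 * lower (lower p) k
  + c 6 * raise (raise (raise p)) k + c 7 * raise (raise (lower p)) k
  + c 8 * raise (lower (lower p)) k + c 9 * lower (lower (lower p)) k.
Proof.
rewrite /cubic !big_ord_recr big_ord0 /= add0r.
by rewrite !(schrM, schr_X, schr_Y, schr1, schrD, schrZ).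
Qed.

Lemma schr_star_cubic c p k : schr (weyl_star (cubic c)) p k =
  conjc (c 0) * p k + conjc (c 1) * raise p k - conjc (c 2) * lower p k
  + conjc (c 3) * raise (raise p) k - conjc (c 4) * lower (raise p) k
  + conjc (c 5) * lower (lower p) k + conjc (c 6) * raise (raise (raise p)) k
  - conjc (c 7) * lower (raise (raise p)) k
  + conjc (c 8) * lower (lower (raise p)) k
  - conjc (c 9) * lower (lower (lower p)) k.
Proof.
rewrite /cubic !big_ord_recr big_ord0 /= add0r.
rewrite !(weyl_starM, weyl_star1, weyl_X_herm, weyl_starY,
  weyl_starD, weyl_starZ).
rewrite !(mulNr, mulrN, opprK).
rewrite !(schrM, schr_X, schr_Y, schr1, schrD, schrN, schrZ).
by ring.
Qed.

Lemma mul_conjc_eq0 (z : C) : conjc z * z = 0 -> z = 0.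
Proof. by move=> /eqP; rewrite mulf_eq0 conjc_eq0 orbb => /eqP. Qed.

Lemma mul_conjc_ge0 (z : C) : 0 <= conjc z * z.
Proof. by rewrite mulrC mulcJ_ge0. Qed.

(** The first tests are squared moduli of single coefficients. Once these
    coefficients vanish, [ell] of the square is a hermitian form in the
    remaining ones, diagonalised explicitly. *)
Lemma lex_ge0_sqr c : lex_ge0 (weyl_star (cubic c) * cubic c).
Proof.
have E n m :=
  congr1 (fun f => f m) (schrM (weyl_star (cubic c)) (cubic c) (delta n)).
have x6 : mel 0 6 (weyl_star (cubic c) * cubic c) = conjc (c 6) * c 6.
  rewrite /mel E schr_star_cubic /lower /raise !schr_cubic.
  by rewrite /lower /raise /delta /=; ring.
have y6 : mel 6 0 (weyl_star (cubic c) * cubic c) =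
    - (720 * (conjc (c 9) * c 9)).
  rewrite /mel E schr_star_cubic /lower /raise !schr_cubic.
  by rewrite /lower /raise /delta /=; ring.
split.
- by rewrite x6 mul_conjc_ge0.
- by rewrite y6 oppr_le0 mulr_ge0 ?ler0n ?mul_conjc_ge0.
rewrite x6 y6 => /mul_conjc_eq0 c6 /eqP; rewrite oppr_eq0 mulf_eq0 pnatr_eq0 /=.
move=> /eqP/mul_conjc_eq0 c9.
have x4 : mel 0 4 (weyl_star (cubic c) * cubic c) = conjc (c 3) * c 3.
  rewrite /mel E schr_star_cubic c6 c9 conjc0 /lower /raise !schr_cubic c6 c9.
  by rewrite /lower /raise /delta /=; ring.
have y4 : mel 4 0 (weyl_star (cubic c) * cubic c) = 24 * (conjc (c 5) * c 5).
  rewrite /mel E schr_star_cubic c6 c9 conjc0 /lower /raise !schr_cubic c6 c9.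
  by rewrite /lower /raise /delta /=; ring.
split.
- by rewrite x4 mul_conjc_ge0.
- by rewrite y4 mulr_ge0 ?ler0n ?mul_conjc_ge0.
rewrite x4 y4 => /mul_conjc_eq0 c3 /eqP; rewrite mulf_eq0 pnatr_eq0 /=.
move=> /eqP/mul_conjc_eq0 c5.
pose sq (z : C) := conjc z * z.
have -> : ell (weyl_star (cubic c) * cubic c) =
    8^-1 * sq (- (3 / 2) * c 7 + 2 * c 8 + c 1 - 4 * c 2)
    + 8^-1 * sq (c 2 - 2^-1 * c 8) + 3 / 4 * sq (c 7 - c 8)
    + sq (c 0 - 2^-1 * c 4) + 2^-1 * sq (c 4).
  rewrite /ell /mel !E !schr_star_cubic c3 c5 c6 c9 conjc0 /lower /raise.
  rewrite !schr_cubic c3 c5 c6 c9 /lower /raise /delta /= /sq; by field.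
have sq0 z : 0 <= sq z by exact: mul_conjc_ge0.
have sqM (a z : C) : 0 <= a -> 0 <= a * sq z by move=> a0; apply: mulr_ge0.
apply: addr_ge0; last by apply: sqM; rewrite invr_ge0 ler0n.
apply: addr_ge0; last exact: sq0.
apply: addr_ge0; last by apply: sqM; rewrite divr_ge0 ?ler0n.
by apply: addr_ge0; apply: sqM; rewrite invr_ge0 ler0n.
Qed.

Lemma schr_N p : schr (weyl_N R) p = (fun k =>
  2^-1 * (raise (raise p) k + raise (lower p) k
          - lower (raise p) k - lower (lower p) k)).
Proof.
apply/funext => k; rewrite -rsqrt2_sqr /weyl_N.
rewrite schrM schr_wa schr_was /schr_as /schr_a /lower.
by case: k => [|k] /=; ring.
Qed.

Lemma horner_alg_N (f : {poly C}) n : (size f <= n)%N ->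
  horner_alg (weyl_N R) f = \sum_(i < n) f`_i *: weyl_N R ^+ i.
Proof.
move=> sf; rewrite /horner_alg /horner_morph.
rewrite (horner_coef_wide (n := n)) ?size_map_poly //.
by apply: eq_bigr => i _; rewrite coef_map /= mulr_algl.
Qed.

(** A polynomial that is nonnegative on the natural numbers may be negative
    elsewhere, so this term need not be a sum of squares. The tests for [X^6],
    [Y^6], [X^4], [Y^4] involve [f] only through its leading coefficient, and
    they vanish together only if [cubic c] is 0. *)
Lemma lex_ge0_quadratic (f : {poly C}) c : size f = 3%N -> 0 <= lead_coef f ->
  (forall i, (2 < i)%N -> c i = 0) ->
  lex_ge0 (weyl_star (cubic c) * horner_alg (weyl_N R) f * cubic c).
Proof.
move=> sf; rewrite lead_coefE sf /= => f2 c0.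
have fn : f`_2 != 0.
  by rewrite -[2%N]/(3.-1) -sf -lead_coefE lead_coef_eq0 -size_poly_eq0 sf.
pose q p := fun k => f`_0 * p k + f`_1 * schr (weyl_N R) p k +
  f`_2 * schr (weyl_N R) (schr (weyl_N R) p) k.
have E n m : mel n m (weyl_star (cubic c) * horner_alg (weyl_N R) f * cubic c)
    = schr (weyl_star (cubic c)) (q (schr (cubic c) (delta n))) m.
  rewrite /mel !schrM; congr (schr _ _ m); apply/funext => k.
  rewrite (@horner_alg_N f 3) ?sf // !big_ord_recr big_ord0 /= add0r.
  by rewrite !(schrD, schrZ) expr0 expr1 schr1 expr2 schrM.
have f2sq z : 0 <= f`_2 * (conjc z * z).
  by apply: mulr_ge0; last exact: mul_conjc_ge0.
have cE : (c 3 = 0) * (c 4 = 0) * (c 5 = 0) * (c 6 = 0) * (c 7 = 0) *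
    (c 8 = 0) * (c 9 = 0).
  by rewrite !c0.
have S3 p : schr (cubic c) p =
    (fun k => c 0 * p k + c 1 * raise p k + c 2 * lower p k).
  by apply/funext => k; rewrite schr_cubic !cE; ring.
have S3s p k : schr (weyl_star (cubic c)) p k =
    conjc (c 0) * p k + conjc (c 1) * raise p k - conjc (c 2) * lower p k.
  by rewrite schr_star_cubic !cE conjc0; ring.
have x6 : mel 0 6 (weyl_star (cubic c) * horner_alg (weyl_N R) f * cubic c)
    = 4^-1 * (f`_2 * (conjc (c 1) * c 1)).
  by rewrite E S3s S3 /q !schr_N /lower /raise /delta /=; field.
have y6 : mel 6 0 (weyl_star (cubic c) * horner_alg (weyl_N R) f * cubic c)
    = - (180 * (f`_2 * (conjc (c 2) * c 2))).
  by rewrite E S3s S3 /q !schr_N /lower /raise /delta /=; field.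
split.
- by rewrite x6; apply: mulr_ge0; [rewrite invr_ge0 ler0n|exact: f2sq].
- by rewrite y6 oppr_le0; apply: mulr_ge0; [rewrite ler0n|exact: f2sq].
rewrite x6 y6 => /eqP.
rewrite !mulf_eq0 invr_eq0 pnatr_eq0 (negbTE fn) conjc_eq0 orbb /=.
move=> /eqP c1 /eqP.
rewrite oppr_eq0 !mulf_eq0 pnatr_eq0 (negbTE fn) conjc_eq0 orbb /=.
move=> /eqP c2.
have x4 : mel 0 4 (weyl_star (cubic c) * horner_alg (weyl_N R) f * cubic c)
    = 4^-1 * (f`_2 * (conjc (c 0) * c 0)).
  by rewrite E S3s S3 c1 c2 conjc0 /q !schr_N /lower /raise /delta /=; field.
have y4 : mel 4 0 (weyl_star (cubic c) * horner_alg (weyl_N R) f * cubic c)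
    = 6 * (f`_2 * (conjc (c 0) * c 0)).
  by rewrite E S3s S3 c1 c2 conjc0 /q !schr_N /lower /raise /delta /=; field.
split.
- by rewrite x4; apply: mulr_ge0; [rewrite invr_ge0 ler0n|exact: f2sq].
- by rewrite y4; apply: mulr_ge0; [rewrite ler0n|exact: f2sq].
rewrite x4 => /eqP.
rewrite !mulf_eq0 invr_eq0 pnatr_eq0 (negbTE fn) conjc_eq0 orbb /=.
move=> /eqP c00 _.
have -> : cubic c = 0.
  rewrite /cubic big1 // => -[i /= _] _.
  by case: i => [|[|[|i]]]; rewrite ?c00 ?c1 ?c2 ?(c0 i.+3) // scale0r.
by rewrite mulr0 ell0.
Qed.

(** The coefficient of [X^6] in [N^3] is [1/8], so for a nonzero constant the
    first test already decides. *)
Lemma lex_ge0_const (f : {poly C}) (c : C) : size f = 4%N -> 0 <= lead_coef f ->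
  lex_ge0 (weyl_star c%:A * horner_alg (weyl_N R) f * c%:A).
Proof.
move=> sf f0; rewrite weyl_starZ weyl_star1.
rewrite -scalerAl mul1r -scalerAr mulr1 scalerA mulrC.
 apply: lex_ge0Z; first exact: mul_conjc_ge0.
move: f0; rewrite lead_coefE sf /= => f0.
have fn : f`_3 != 0.
  by rewrite -[3%N]/(4.-1) -sf -lead_coefE lead_coef_eq0 -size_poly_eq0 sf.
have E n m : mel n m (horner_alg (weyl_N R) f) =
    f`_0 * delta n m + f`_1 * schr (weyl_N R) (delta n) m +
    f`_2 * schr (weyl_N R) (schr (weyl_N R) (delta n)) m +
    f`_3 * schr (weyl_N R) (schr (weyl_N R) (schr (weyl_N R) (delta n))) m.
  rewrite /mel (@horner_alg_N f 4) ?sf // !big_ord_recr big_ord0 /= add0r.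
  by rewrite !(schrD, schrZ) expr0 expr1 schr1 !exprS expr0 mulr1 !schrM.
have x6 : mel 0 6 (horner_alg (weyl_N R) f) = 8^-1 * f`_3.
  by rewrite E !schr_N /lower /raise /delta /=; field.
have y6 : mel 6 0 (horner_alg (weyl_N R) f) = - (90 * f`_3).
  by rewrite E !schr_N /lower /raise /delta /=; field.
split.
- by rewrite x6 mulr_ge0 ?invr_ge0 ?ler0n.
- by rewrite y6 oppr_le0 mulr_ge0 ?ler0n.
by rewrite x6 => /eqP; rewrite mulf_eq0 invr_eq0 pnatr_eq0 (negbTE fn).
Qed.

End Lex.

(** * Decomposition into weight components of the number operator *)

Section Normal.
Variable R : rcfType.
Local Notation C := R[i].
Implicit Types (u v g h : weyl R) (p q : {poly C}) (P Q : {poly {poly C}}).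
Local Notation a := (weyl_a R).
Local Notation b := (weyl_as R).
Local Notation N := (weyl_N R).
Local Notation H := (horner_alg N).

Lemma weyl_abE : a * b = N + 1.
Proof. by rewrite -(weyl_rel R) addrC subrK. Qed.

Lemma weyl_aN : a * N = (N + 1) * a.
Proof. by rewrite /weyl_N mulrA weyl_abE. Qed.

Lemma weyl_bN : b * N = (N - 1) * b.
Proof.
by rewrite mulrBl mul1r /weyl_N -(mulrA b a b) weyl_abE mulrDr mulr1 addrK.
Qed.

(** The generators change the eigenvalue of the number operator by one, hence
    pass through its polynomials at the price of a translation. *)
Lemma horner_alg_shift (x n : weyl R) (c : C) p : x * n = (n + c%:A) * x ->
  x * horner_alg n p = horner_alg n (p \Po ('X + c%:P)) * x.
Proof.
move=> xn; elim/poly_ind: p => [|p d IH].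
  by rewrite comp_poly0 rmorph0 mulr0 mul0r.
rewrite comp_poly_MXaddC !rmorphD !rmorphM /= !(horner_algX, horner_algC).
rewrite rmorphD /= horner_algX horner_algC mulrDr mulrDl mulrA IH.
by rewrite -[_ * x * n]mulrA xn mulrA -scalerAr -scalerAl mul1r mulr1.
Qed.

Lemma aH p : a * H p = H (p \Po ('X + 1%:P)) * a.
Proof. by apply: horner_alg_shift; rewrite scale1r weyl_aN. Qed.

Lemma bH p : b * H p = H (p \Po ('X + (-1)%:P)) * b.
Proof. by apply: horner_alg_shift; rewrite scaleN1r weyl_bN. Qed.

Lemma abX j : a * b ^+ j.+1 = b ^+ j * (N + (j.+1%:R)%:A).
Proof.
elim: j => [|j IH]; first by rewrite expr0 expr1 mul1r scale1r weyl_abE.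
rewrite exprSr mulrA IH exprSr -!mulrA; congr (_ * _).
rewrite mulrDl -scalerAl mul1r mulrDr -scalerAr mulr1.
have -> : N * b = b * N + b by rewrite weyl_bN mulrBl mul1r subrK.
by rewrite -addrA -[j.+2]add1n natrD scalerDl scale1r.
Qed.

(** Sorting by weight for the number operator: the coefficients of [P] describe
    the components of weight [j], those of [Q] the components of weight
    [- (j + 1)]. Polynomials with polynomial coefficients serve as finitely
    supported families. *)
Definition dec P Q : weyl R :=
  \sum_(j < size P) b ^+ j * H P`_j + \sum_(j < size Q) H Q`_j * a ^+ j.+1.

Lemma dec_widen n m P Q : (size P <= n)%N -> (size Q <= m)%N ->
  dec P Q = \sum_(j < n) b ^+ j * H P`_j + \sum_(j < m) H Q`_j * a ^+ j.+1.
Proof.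
move=> sP sQ; congr (_ + _).
  rewrite (big_ord_widen n (fun j => b ^+ j * H P`_j) sP) big_mkcond /=.
  apply: eq_bigr => i _; case: ltnP => // /(nth_default 0) ->.
  by rewrite rmorph0 mulr0.
rewrite (big_ord_widen m (fun j => H Q`_j * a ^+ j.+1) sQ) big_mkcond /=.
apply: eq_bigr => i _; case: ltnP => // /(nth_default 0) ->.
by rewrite rmorph0 mul0r.
Qed.

Definition decomposable u := exists P Q, u = dec P Q.

Lemma decomposableD u v :
  decomposable u -> decomposable v -> decomposable (u + v).
Proof.
move=> [P1 [Q1 ->]] [P2 [Q2 ->]]; exists (P1 + P2), (Q1 + Q2).
pose n := maxn (size P1) (size P2); pose m := maxn (size Q1) (size Q2).
rewrite (@dec_widen n m P1 Q1) ?leq_maxl // (@dec_widen n m P2 Q2) ?leq_maxr //.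
rewrite (@dec_widen n m (P1 + P2) (Q1 + Q2)) ?size_polyD //.
rewrite addrACA -!big_split /=; congr (_ + _); apply: eq_bigr => i _.
  by rewrite coefD rmorphD mulrDr.
by rewrite coefD rmorphD mulrDl.
Qed.

Lemma decomposable0 : decomposable 0.
Proof. by exists 0, 0; rewrite /dec size_poly0 !big_ord0 addr0. Qed.

Lemma decomposable_bH j p : decomposable (b ^+ j * H p).
Proof.
exists (p *: 'X^j), 0; have sX : (size (p *: 'X^j) <= j.+1)%N.
  by apply: leq_trans (size_scale_leq _ _) _; rewrite size_polyXn.
rewrite (dec_widen sX (leqnn _)) size_poly0 big_ord0 addr0 big_ord_recr /=.
rewrite big1 ?add0r => [|i _].
  by rewrite coefZ coefXn eqxx mulr1.
by rewrite coefZ coefXn ltn_eqF // mulr0 rmorph0 mulr0.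
Qed.

Lemma decomposable_Ha j p : decomposable (H p * a ^+ j).
Proof.
case: j => [|j].
  by rewrite expr0 mulr1 -[H p]mul1r; apply: (@decomposable_bH 0).
exists 0, (p *: 'X^j); have sX : (size (p *: 'X^j) <= j.+1)%N.
  by apply: leq_trans (size_scale_leq _ _) _; rewrite size_polyXn.
rewrite (dec_widen (leqnn _) sX) size_poly0 big_ord0 add0r big_ord_recr /=.
rewrite big1 ?add0r => [|i _].
  by rewrite coefZ coefXn eqxx mulr1.
by rewrite coefZ coefXn ltn_eqF // mulr0 rmorph0 mul0r.
Qed.

Lemma decomposableM x P Q :
  (forall j p, decomposable (x * (b ^+ j * H p))) ->
  (forall j p, decomposable (x * (H p * a ^+ j))) ->
  decomposable (x * dec P Q).
Proof.
move=> xb xa; rewrite mulrDr !mulr_sumr; apply: decomposableD;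
  by apply: big_ind => // [|u v]; [exact: decomposable0|exact: decomposableD].
Qed.

Lemma decomposable_mul u v : decomposable v -> decomposable (u * v).
Proof.
rewrite -(weyl_termK u).
elim: (weyl_term u) v => {u} [||c|x IHx y IHy|x IHx y IHy] v dv.
- have [P [Q ->]] := dv; apply: decomposableM => j p.
    case: j => [|j].
      rewrite mul1r aH -[_ * weyl_a R]/(_ * a ^+ 1).
      exact: decomposable_Ha.
    rewrite mulrA abX -mulrA.
    have -> : (N + (j.+1%:R)%:A) * H p = H (('X + (j.+1%:R)%:P) * p).
      by rewrite rmorphM rmorphD /= horner_algX horner_algC.
    exact: decomposable_bH.
  by rewrite mulrA aH -mulrA -exprS; exact: decomposable_Ha.
- have [P [Q ->]] := dv; apply: decomposableM => j p.
    by rewrite mulrA -exprS; exact: decomposable_bH.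
  case: j => [|j].
    rewrite mulr1 -[_ * H p]/(b ^+ 1 * H p); exact: decomposable_bH.
  rewrite mulrA bH exprS -mulrA [b * _]mulrA -/N.
  set r := _ \Po _; have -> : H r * (N * a ^+ j) = H (r * 'X) * a ^+ j.
    by rewrite rmorphM /= horner_algX mulrA.
  exact: decomposable_Ha.
- have [P [Q ->]] := dv.
  have cH p : c *: H p = H (c%:P * p).
    by rewrite rmorphM /= horner_algC mulr_algl.
  rewrite weyl_ofC; apply: decomposableM => j p; rewrite -scalerAl mul1r.
    by rewrite scalerAr cH; exact: decomposable_bH.
  by rewrite scalerAl cH; exact: decomposable_Ha.
- by rewrite weyl_ofD mulrDl; apply: decomposableD; [exact: IHx|exact: IHy].
- by rewrite weyl_ofM -mulrA; apply/IHx/IHy.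
Qed.

(** The decomposable elements contain 1 and form a left ideal. *)
Lemma weyl_decomposable u : decomposable u.
Proof.
rewrite -[u]mulr1; apply: decomposable_mul.
by have := @decomposable_bH 0 1; rewrite rmorph1 !mulr1.
Qed.

End Normal.

(** * Diagonal matrix elements *)

Section Diagonal.
Variable R : rcfType.
Local Notation C := R[i].
Implicit Types (u v g h : weyl R) (p f : {poly C}) (P Q : {poly {poly C}})
  (q : nat -> C).
Local Notation a := (weyl_a R).
Local Notation b := (weyl_as R).
Local Notation N := (weyl_N R).
Local Notation H := (horner_alg N).

Lemma barg_sum (n : nat) (F : 'I_n -> weyl R) q k :
  barg (\sum_(i < n) F i) q k = \sum_(i < n) barg (F i) q k.
Proof. exact: (act_sum (@lower_lin R) (@raise_lin R) (@lower_raise R)). Qed.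

Lemma barg0 q k : barg 0 q k = 0.
Proof. exact: (act0 (@lower_lin R) (@raise_lin R) (@lower_raise R)). Qed.

Lemma barg_bX j q k : barg (b ^+ j) q k = if (k < j)%N then 0 else q (k - j)%N.
Proof.
elim: j k => [|j IH] k; first by rewrite expr0 barg1 subn0.
by rewrite exprS bargM barg_as; case: k => [|k] //=.
Qed.

Lemma barg_aX j q k : barg (a ^+ j) q k = ((k + j) ^_ j)%:R * q (k + j)%N.
Proof.
elim: j k => [|j IH] k; first by rewrite expr0 barg1 addn0 ffactn0 mul1r.
rewrite exprS bargM barg_a /lower IH addSnnS mulrA -natrM; congr (_%:R * _).
by rewrite [in RHS]ffactnSr mulnC addnS subSn ?addnK // leq_addl.
Qed.

Lemma barg_N q k : barg N q k = k%:R * q k.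
Proof.
by rewrite /weyl_N bargM barg_as barg_a; case: k => [|k] //=; rewrite mul0r.
Qed.

Lemma barg_H p q k : barg (H p) q k = p.[k%:R] * q k.
Proof.
elim/poly_ind: p => [|p c IH]; first by rewrite rmorph0 barg0 horner0 mul0r.
rewrite rmorphD rmorphM /= horner_algX horner_algC bargD bargZ barg1.
rewrite hornerMXaddC.
rewrite mulrDl; congr (_ + _).
have -> : H p * N = N * H p by rewrite -{2 3}(horner_algX N) -!rmorphM /= mulrC.
by rewrite bargM barg_N IH mulrCA mulrA.
Qed.

(** Each entry of the matrix of [dec P Q] involves a single component, since
    different components have different weights. *)
Lemma barg_dec_raising P Q k j :
  barg (dec P Q) (delta R k) (k + j)%N = (P`_j).[k%:R].
Proof.
rewrite (dec_widen (leq_maxl (size P) j.+1) (leqnn _)) bargD !barg_sum.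
rewrite [X in _ + X]big1 ?addr0 => [|i _]; last first.
  rewrite bargM barg_H barg_aX /delta.
  have -> : (k + j + i.+1 == k)%N = false by lia.
  by rewrite !mulr0.
have jn : (j < maxn (size P) j.+1)%N by rewrite leq_max ltnSn orbT.
rewrite (bigD1 (Ordinal jn)) //= [X in _ + X]big1 ?addr0 => [|i ij].
  rewrite bargM barg_bX ltnNge leq_addl /= addnK barg_H /delta eqxx mulr1 //.
rewrite bargM barg_bX; case: ltnP => // ikj; rewrite barg_H /delta.
case: eqP => [e|_]; last by rewrite mulr0.
by move: ij; rewrite -val_eqE /=; lia.
Qed.

Lemma barg_dec_lowering P Q m j :
  barg (dec P Q) (delta R (m + j.+1)) m =
  (Q`_j).[m%:R] * ((m + j.+1) ^_ j.+1)%:R.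
Proof.
rewrite (dec_widen (leqnn _) (leq_maxl (size Q) j.+1)) bargD !barg_sum.
rewrite [X in X + _]big1 ?add0r => [|i _]; last first.
  rewrite bargM barg_bX; case: ltnP => // im; rewrite barg_H /delta.
  have -> : (m - i == m + j.+1)%N = false by lia.
  by rewrite mulr0.
have jn : (j < maxn (size Q) j.+1)%N by rewrite leq_max ltnSn orbT.
rewrite (bigD1 (Ordinal jn)) //= [X in _ + X]big1 ?addr0 => [|i ij].
  by rewrite bargM barg_H barg_aX /delta eqxx mulr1.
rewrite bargM barg_H barg_aX /delta eqn_add2l eqSS.
by move: ij; rewrite -val_eqE /= => /negbTE ->; rewrite !mulr0.
Qed.

Lemma weyl_star_sum n (F : 'I_n -> weyl R) :
  weyl_star (\sum_(i < n) F i) = \sum_(i < n) weyl_star (F i).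
Proof.
apply: (big_morph _ (@weyl_starD R)).
by rewrite -(scale0r 0) weyl_starZ conjc0 !scale0r.
Qed.

Lemma weyl_starX u n : weyl_star (u ^+ n) = weyl_star u ^+ n.
Proof.
elim: n => [|n IH]; first by rewrite !expr0 weyl_star1.
by rewrite exprS weyl_starM IH -exprSr.
Qed.

Lemma weyl_star_N : weyl_star N = N.
Proof. by rewrite /weyl_N weyl_starM weyl_star_a weyl_star_as. Qed.

Lemma weyl_starH p : weyl_star (H p) = H (map_poly conjc p).
Proof.
elim/poly_ind: p => [|p c IH].
  by rewrite rmorph0 map_poly0 rmorph0 -(scale0r 0) weyl_starZ conjc0 !scale0r.
rewrite rmorphD rmorphM /= horner_algX horner_algC.
rewrite (rmorphD (map_poly (@conjc R))) (rmorphM (map_poly (@conjc R))) /=.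
rewrite map_polyX map_polyC /= rmorphD rmorphM /= horner_algX horner_algC.
rewrite weyl_starD weyl_starM weyl_star_N weyl_starZ weyl_star1 IH.
by congr (_ + _); rewrite -{1 4}(horner_algX N) -!rmorphM /= mulrC.
Qed.

(** At the vacuum the terms [b^(j+1) ...] of the adjoint contribute nothing,
    and [a^j] picks out the coefficient [j] with the factor [j!], the squared
    norm of the basis vector in this normalisation. *)
Lemma barg_star_dec P Q q : barg (weyl_star (dec P Q)) q 0 =
  \sum_(j < size P) conjc ((P`_j).[0]) * j`!%:R * q j.
Proof.
rewrite weyl_starD !weyl_star_sum bargD !barg_sum.
rewrite [X in _ + X]big1 ?addr0 => [|i _]; last first.
  by rewrite weyl_starM weyl_starX weyl_star_a bargM barg_bX.
apply: eq_bigr => j _.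
rewrite weyl_starM weyl_starX weyl_star_as weyl_starH bargM barg_H barg_aX.
rewrite add0n ffactnn.
rewrite mulrA; congr (_ * _ * _).
by have := horner_map (@conjc R) (P`_j) 0; rewrite (rmorph0 (@conjc R)).
Qed.

(** The norm formula [<f(N) g e_k, g e_k>] in the unnormalised basis. It is
    reduced to the vacuum by replacing [g] with [g b^k]. *)
Lemma diag_sum f g k : exists M,
  k`!%:R * barg (weyl_star g * H f * g) (delta R k) k =
    \sum_(l < M) f.[l%:R] * (l`!%:R *
      (conjc (barg g (delta R k) l) * barg g (delta R k) l))
  /\ (forall l, (M <= l)%N -> barg g (delta R k) l = 0).
Proof.
have [P [Q hE]] := weyl_decomposable (g * b ^+ k).
have dk : barg (b ^+ k) (delta R 0) = delta R k.
  apply/funext => l; rewrite barg_bX /delta; case: ltnP => kl.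
    by rewrite ltn_eqF.
  by rewrite subn_eq0 eqn_leq kl andbT.
have vE l : barg g (delta R k) l = (P`_l).[0].
  by rewrite -dk -bargM hE -(@barg_dec_raising P Q 0 l) add0n.
exists (size P); split; last first.
  by move=> l /(nth_default 0) Pl; rewrite vE Pl horner0.
transitivity (barg (weyl_star (g * b ^+ k) * H f * (g * b ^+ k)) (delta R 0) 0).
  rewrite weyl_starM weyl_starX weyl_star_as mulrA -!(mulrA (a ^+ k)) !bargM dk.
  by rewrite barg_aX add0n ffactnn.
rewrite bargM bargM {1}hE barg_star_dec; apply: eq_bigr => l _.
by rewrite barg_H bargM dk -vE; ring.
Qed.

Lemma diag_ge f g k l : (forall n : nat, 0 <= f.[n%:R]) ->
  f.[l%:R] * (l`!%:R * (conjc (barg g (delta R k) l) * barg g (delta R k) l))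
  <= k`!%:R * barg (weyl_star g * H f * g) (delta R k) k.
Proof.
move=> f0; have [M [-> vM]] := diag_sum f g k.
have t0 i : 0 <= f.[i%:R] * (i`!%:R *
    (conjc (barg g (delta R k) i) * barg g (delta R k) i)).
  by rewrite mulr_ge0 // mulr_ge0 ?ler0n // mul_conjc_ge0.
have [Ml|lM] := leqP M l.
  by rewrite vM // mulr0 !mulr0; apply: sumr_ge0 => i _; exact: t0.
by rewrite (bigD1 (Ordinal lM)) //= lerDl; apply: sumr_ge0 => i _; exact: t0.
Qed.

End Diagonal.

(** * Polynomials bounded on the natural numbers *)

Section Growth.
Variable R : realType.
Local Notation C := R[i].
Implicit Types (p q f D : {poly C}).

Lemma poly_nat_eq0 p : (forall n : nat, p.[n%:R] = 0) -> p = 0.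
Proof.
move=> p0; apply: (@roots_geq_poly_eq0 _ p [seq n%:R | n <- iota 0 (size p)]).
- by apply/allP => _ /mapP[n _ ->]; rewrite /root p0.
- rewrite map_inj_uniq ?iota_uniq // => m n /eqP; rewrite eqr_nat.
  by move=> /eqP.
- by rewrite size_map size_iota.
Qed.

(** Such a polynomial agrees with its conjugate at infinitely many points, hence
    has real coefficients, and a real polynomial with negative leading
    coefficient is eventually negative. *)
Lemma lead_coef_ge0 p : (forall n : nat, 0 <= p.[n%:R]) -> 0 <= lead_coef p.
Proof.
move=> p0.
have pJ : p = map_poly conjc p.
  apply/eqP; rewrite -subr_eq0; apply/eqP/poly_nat_eq0 => n.
  have := horner_map (@conjc R) p n%:R; rewrite /= conjc_nat => pn.
  rewrite hornerD hornerN pn; move: (p0 n); case: (p.[_]) => x y.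
  by rewrite lecE /= => /andP[/eqP -> _]; rewrite oppr0 subrr.
pose q : {poly R} := \poly_(i < size p) complex.Re p`_i.
have pE : p = map_poly (real_complex R) q.
  apply/polyP => i; rewrite coef_map coef_poly.
  have : p`_i = conjc p`_i by rewrite {1}pJ coef_map.
  case: ltnP => [_|/(nth_default 0) -> //].
  case: (p`_i) => x y [] /eqP; rewrite -subr_eq0 opprK -mulr2n mulrn_eq0 /=.
  by move=> /eqP ->.
rewrite pE lead_coef_map /= lecR leNgt; apply/negP => q0.
have [n0 nP] : exists n0, forall x, x >= n0 -> (- q).[x] >= lead_coef (- q).
  by apply: poly_pinfty_gt_lc; rewrite lead_coefN oppr_gt0.
have := nP _ (le_trans (ler_norm n0) (ltW (archi_boundP (normr_ge0 n0)))).
set n := Num.Def.archi_bound _; have := p0 n.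
rewrite pE -(rmorph_nat (real_complex R)) horner_map lecR hornerN lead_coefN.
by move=> qn0; rewrite lerN2 => /(le_trans qn0); rewrite leNgt q0.
Qed.

(** Otherwise [p] and [q - p] would have opposite leading coefficients. *)
Lemma size_le_dominating p q : (forall n : nat, 0 <= p.[n%:R]) ->
  (forall n : nat, p.[n%:R] <= q.[n%:R]) -> (size p <= size q)%N.
Proof.
move=> p0 pq; rewrite leqNgt; apply/negP => qp.
have : 0 <= lead_coef (q - p).
  by apply: lead_coef_ge0 => n; rewrite hornerD hornerN subr_ge0.
rewrite lead_coefDr ?size_polyN // lead_coefN oppr_ge0 => lp.
have := lead_coef_ge0 p0; rewrite le_eqVlt => /orP[|lp0]; last first.
  by have := le_lt_trans lp lp0; rewrite ltxx.
rewrite eq_sym lead_coef_eq0 => /eqP p00.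
by move: qp; rewrite p00 size_poly0 ltn0.
Qed.

(** The polynomial [(k + j)! / k!] in [k]: the ratio of the squared norms of two
    basis vectors at distance [j]. *)
Definition rising (j : nat) : {poly C} := \prod_(i < j) ('X + (i.+1%:R)%:P).

Lemma size_rising j : size (rising j) = j.+1.
Proof.
rewrite /rising; under eq_bigr do rewrite -[_%:P]opprK -polyCN.
rewrite -(big_mkord xpredT (fun i => 'X - (- i.+1%:R)%:P)) size_prod_XsubC.
by rewrite size_iota subn0.
Qed.

Lemma horner_rising j k : (rising j).[k%:R] * k`!%:R = (k + j)`!%:R.
Proof.
elim: j => [|j IH]; first by rewrite /rising big_ord0 hornerC mul1r addn0.
rewrite /rising big_ord_recr /= hornerM -/(rising j) hornerD hornerX hornerC.
by rewrite addnS factS natrM -IH -addnS natrD; ring.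
Qed.

Lemma degree_bound f p D j s : f != 0 -> p != 0 ->
  (forall n : nat, 0 <= f.[n%:R]) ->
  (forall k : nat, f.[(k + s)%:R] *
     ((rising j).[k%:R] * (conjc p.[k%:R] * p.[k%:R])) <= D.[k%:R]) ->
  ((size f).-1 + ((size p).-1.*2 + j) < size D)%N.
Proof.
move=> fn pn f0 fpD.
pose pJ := map_poly conjc p.
have szJ : size pJ = size p.
  by rewrite size_map_inj_poly ?conjc0 //; exact: (can_inj (@conjcK R)).
have pJn : pJ != 0 by rewrite -size_poly_eq0 szJ size_poly_eq0.
pose F := f \Po ('X + s%:R%:P).
have szF : size F = size f by rewrite size_comp_poly2 // size_XaddC.
have Fn : F != 0 by rewrite -size_poly_eq0 szF size_poly_eq0.
have rn : rising j != 0 by rewrite -size_poly_eq0 size_rising.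
have hE k : (F * (rising j * (pJ * p))).[k%:R] =
    f.[(k + s)%:R] * ((rising j).[k%:R] * (conjc p.[k%:R] * p.[k%:R])).
  rewrite !hornerM horner_comp hornerD hornerX hornerC -natrD.
  congr (_ * (_ * (_ * _))).
  by have := horner_map (@conjc R) p k%:R; rewrite /= conjc_nat.
have := @size_le_dominating (F * (rising j * (pJ * p))) D.
rewrite !size_mul ?mulf_neq0 // szF szJ size_rising.
have := fn; have := pn; rewrite -!size_poly_eq0 => sp sf H.
suff : ((size f + (j.+1 + (size p + size p).-1).-1).-1 <= size D)%N by lia.
apply: H => n; rewrite hE //.
rewrite mulr_ge0 // mulr_ge0 ?mul_conjc_ge0 //.
by rewrite -(pmulr_lge0 _ (_ : 0 < n`!%:R)) ?horner_rising ?ler0n ?ltr0n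
  ?fact_gt0.
Qed.

End Growth.

(** * Separation from the quadratic module *)

Section Separation.
Variable R : realType.
Local Notation C := R[i].
Implicit Types (g : weyl R) (f : {poly C}).
Local Notation a := (weyl_a R).
Local Notation b := (weyl_as R).
Local Notation N := (weyl_N R).
Local Notation H := (horner_alg N).

Definition diag_poly : {poly C} :=
  'X^3 + (- 'X^2 + ((7 / 2)%:P * 'X + (2 / 5)%:P)).

Lemma size_diag_poly : size diag_poly = 4%N.
Proof.
rewrite /diag_poly size_polyDl ?size_polyXn // ltnS.
rewrite (leq_trans (size_polyD _ _)) // geq_max size_polyN size_polyXn /=.
rewrite (leq_trans (size_polyD _ _)) // geq_max.
apply/andP; split; last exact: leq_trans (size_polyC_leq1 _) _.
apply: leq_trans (size_polyMleq _ _) _; rewrite size_polyX addn2 ltnS /=.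
exact: leq_trans (size_polyC_leq1 _) _.
Qed.

Lemma diag_shifted k : barg (shifted_L5 R) (delta R k) k = diag_poly.[k%:R].
Proof.
have u2 : raise (raise (delta R k)) k = 0.
  case: k => [|[|k]] //=; rewrite /delta.
  by have -> : (k == k.+2) = false by lia.
have u4 : raise (raise (raise (raise (delta R k)))) k = 0.
  case: k {u2} => [|[|[|[|k]]]] //=; rewrite /delta.
  by have -> : (k == k.+4) = false by lia.
rewrite /shifted_L5 bargD bargZ barg1 barg_L5 u2 u4 /delta.
have -> : (k.+2 == k) = false by lia.
have -> : (k.+4 == k) = false by lia.
rewrite eqxx /diag_poly !hornerD hornerN !hornerXn hornerM hornerX !hornerC /=.
by field.
Qed.

Lemma filt_dec n (P Q : {poly {poly C}}) :
  (forall j, P`_j != 0 -> ((size (P`_j)%R).-1.*2 + j <= n)%N) ->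
  (forall j, Q`_j != 0 -> ((size (Q`_j)%R).-1.*2 + j.+1 <= n)%N) ->
  filt n (dec P Q).
Proof.
move=> hP hQ; apply: filtD; apply: big_ind => [|u v|j _].
- exact: filt0.
- exact: filtD.
- have [->|Pj] := eqVneq P`_j 0; first by rewrite rmorph0 mulr0; exact: filt0.
  apply: filt_le (hP _ Pj) _; rewrite addnC; apply: filt_asXM.
  rewrite -[H _]mulr1 -[X in filt X]addn0; apply: filt_hornerM; exact: filt1.
- exact: filt0.
- exact: filtD.
- have [->|Qj] := eqVneq Q`_j 0; first by rewrite rmorph0 mul0r; exact: filt0.
  apply: filt_le (hQ _ Qj) _; apply: filt_hornerM.
  rewrite -[_ ^+ _]mulr1 -[X in filt X]addn0; apply: filt_aXM; exact: filt1.
Qed.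

Lemma dec_eq0 (P Q : {poly {poly C}}) :
  (forall j, P`_j = 0) -> (forall j, Q`_j = 0) -> dec P Q = 0.
Proof.
move=> P0 Q0; rewrite /dec !big1 ?addr0 // => j _.
  by rewrite Q0 rmorph0 mul0r.
by rewrite P0 rmorph0 mulr0.
Qed.

Lemma spanned_cubic n g : (n <= 10)%N -> spanned n g ->
  exists c : nat -> C, g = cubic c /\ forall i, (n <= i)%N -> c i = 0.
Proof.
move=> n10 [c ->]; exists (fun i => if (i < n)%N then c i else 0).
split; last first.
  by move=> i ni; rewrite ltnNge ni.
rewrite /cubic (big_ord_widen 10 (fun i => c i *: mon R i) n10) big_mkcond /=.
by apply: eq_bigr => i _; case: ifP; rewrite ?scale0r.
Qed.

Lemma lex_ge0_star_mul g : filt 3 g -> lex_ge0 (weyl_star g * g).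
Proof.
move=> /filt3_spanned/(spanned_cubic (leqnn _))[c [-> _]].
exact: lex_ge0_sqr.
Qed.

(** The bound on the contributions of [g^* f(N) g] to the diagonal that holds
    when this term is part of a sum equal to [L5 + 7/5]. *)
Definition diag_dominated f g := forall k l : nat,
  f.[l%:R] * (l`!%:R * (conjc (barg g (delta R k) l) * barg g (delta R k) l))
  <= k`!%:R * diag_poly.[k%:R].

Lemma degree_bound_raising f P Q j :
  f != 0 -> (forall n : nat, 0 <= f.[n%:R]) ->
  diag_dominated f (dec P Q) -> P`_j != 0 ->
  ((size f).-1 + ((size (P`_j)%R).-1.*2 + j) <= 3)%N.
Proof.
move=> fn f0 dd Pj; rewrite -ltnS -size_diag_poly.
apply: (degree_bound (s := j)) => // k.
have k0 : 0 < k`!%:R :> C by rewrite ltr0n fact_gt0.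
rewrite -(ler_pM2l k0); apply: le_trans (dd k (k + j)%N).
rewrite barg_dec_raising -horner_rising le_eqVlt; apply/orP; left.
by apply/eqP; ring.
Qed.

(** For a component of weight [- (j + 1)] the position reached, [m], is taken as
    the variable, and the starting position is [m + j + 1]. *)
Lemma degree_bound_lowering f P Q j :
  f != 0 -> (forall n : nat, 0 <= f.[n%:R]) ->
  diag_dominated f (dec P Q) -> Q`_j != 0 ->
  ((size f).-1 + ((size (Q`_j)%R).-1.*2 + j.+1) <= 3)%N.
Proof.
move=> fn f0 dd Qj; rewrite -ltnS -size_diag_poly.
have -> : size diag_poly = size (diag_poly \Po ('X + j.+1%:R%:P)).
  by rewrite size_comp_poly2 // size_XaddC.
apply: (degree_bound (s := 0)) => // m.
have m0 : 0 < m`!%:R :> C by rewrite ltr0n fact_gt0.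
have mj0 : 0 < (m + j.+1)`!%:R :> C by rewrite ltr0n fact_gt0.
rewrite horner_comp addn0 (_ : ('X + _).[_] = (m + j.+1)%:R); last first.
  by rewrite hornerD hornerX hornerC natrD.
rewrite -(ler_pM2l mj0); apply: le_trans (dd (m + j.+1)%N m).
rewrite barg_dec_lowering (rmorphM (@conjc R)) (rmorph_nat (@conjc R)).
have e : ((m + j.+1) ^_ j.+1)%:R = (rising R j.+1).[m%:R] :> C.
  apply: (mulIf (lt0r_neq0 m0)); rewrite horner_rising -natrM.
  by rewrite -(ffact_fact (n := m + j.+1) (m := j.+1)) ?leq_addl // addnK.
by rewrite e -horner_rising le_eqVlt; apply/orP; left; apply/eqP; ring.
Qed.

(** The degree bound leaves one case for each degree of [f]. For degree 1 the
    coefficients of [f] are nonnegative and [N = a^* a], so the term is a sum of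
    squares; for degree at least 4 the element [g] is 0. *)
Lemma lex_ge0_term f g : (forall n : nat, 0 <= f.[n%:R]) ->
  diag_dominated f g -> lex_ge0 (weyl_star g * H f * g).
Proof.
move=> f0 dd.
have [->|fn] := eqVneq f 0.
  by rewrite rmorph0 mulr0 mul0r; exact: lex_ge00.
have lf := lead_coef_ge0 f0.
have [P [Q gE]] := weyl_decomposable g.
rewrite gE in dd.
have hP j := degree_bound_raising fn f0 dd (j := j).
have hQ j := degree_bound_lowering fn f0 dd (j := j).
have gfilt n : (n + (size f).-1 = 3)%N -> filt n g.
  move=> nf; rewrite gE; apply: filt_dec => j.
    by move=> /hP; rewrite -nf addnC leq_add2r.
  by move=> /hQ; rewrite -nf addnC leq_add2r.
have fE n : (size f <= n)%N -> H f = \sum_(i < n) f`_i *: N ^+ i.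
  exact: horner_alg_N.
have f00 : 0 <= f`_0 by rewrite -horner_coef0; exact: (f0 0%N).
case sf: (size f) gfilt => [|[|[|[|[|d]]]]] gfilt.
- by move: fn; rewrite -size_poly_eq0 sf.
- rewrite (fE 1%N) ?sf // big_ord1 expr0 mulr_algr -scalerAl.
  by apply/lex_ge0Z/lex_ge0_star_mul => //; exact: (gfilt 3%N).
- rewrite (fE 2%N) ?sf // big_ord_recr big_ord1 /= expr0 expr1.
  rewrite mulrDr mulrDl mulr_algr -scalerAl -scalerAr -scalerAl.
  have g2 : filt 2 g by exact: (gfilt 2%N).
  apply: lex_ge0D; apply: lex_ge0Z => //.
  + exact/lex_ge0_star_mul/filtS.
  + by move: lf; rewrite lead_coefE sf.
  + have -> : weyl_star g * N * g = weyl_star (a * g) * (a * g).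
      by rewrite weyl_starM weyl_star_a /weyl_N !mulrA.
    exact/lex_ge0_star_mul/filt_aM.
- have g1 : filt 1 g by exact: (gfilt 1%N).
  have [//|c] := spanned_cubic (n := 3) _ (filt1_spanned g1).
  move=> [-> c0]; exact: lex_ge0_quadratic.
- have [c ->] : filt 0 g by exact: (gfilt 0%N).
  exact: lex_ge0_const.
- suff -> : g = 0 by rewrite mulr0; exact: lex_ge00.
  rewrite gE; apply: dec_eq0 => j; apply/eqP; apply: contraT.
    by move=> /hP; rewrite sf /= !addSn.
  by move=> /hQ; rewrite sf /= !addSn.
Qed.

Lemma shifted_L5_not_qm : ~ quadratic_module (PosN0 R) (shifted_L5 R).
Proof.
move=> [m [s [g [_ sP uE]]]].
have {}sP i : exists2 f : {poly C}, (forall n : nat, 0 <= f.[n%:R]) & H f = s i.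
  by case: (sP i) => f f0 fs; exists f.
pose f i : {poly C} := s2val (cid2 (sP i)).
have f0 i n : 0 <= (f i).[n%:R] by rewrite /f; case: cid2.
have fE i : H (f i) = s i by rewrite /f; case: cid2.
pose T i := weyl_star (g i) * H (f i) * g i.
have {}uE : shifted_L5 R = \sum_(i < m) T i.
  by rewrite uE; apply: eq_bigr => i _; rewrite /T fE.
apply: (@not_lex_shifted R); rewrite uE.
apply: big_ind => [|u v|i _]; [exact: lex_ge00|exact: lex_ge0D|].
apply: lex_ge0_term => // k l.
apply: le_trans (diag_ge (g i) k l (f0 i)) _.
rewrite ler_wpM2l ?ler0n // -diag_shifted uE barg_sum (bigD1 i) //= lerDl.
apply: sumr_ge0 => j _.
have := diag_ge (g j) k k (f0 j).
have k0 : 0 < k`!%:R :> C by rewrite ltr0n fact_gt0.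
rewrite -(pmulr_rge0 _ k0); apply: le_trans.
by rewrite mulr_ge0 // mulr_ge0 ?ler0n // mul_conjc_ge0.
Qed.

End Separation.

End WeylSeparation.

Theorem proposition9p1 (R : realType) :
  (Aplus R `\` quadratic_module (PosN0 R)) (weyl_L5 R + (14 / 10)%:A).
Proof. by split; [exact: shifted_L5_Aplus|exact: shifted_L5_not_qm]. Qed.
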